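(* Let $i\ge 2$ be an integer and let $g\ge 1$ be an integer. For $g\ge 1$ put $H(g)=\left\lfloor \frac{7+\sqrt{24g+1}}{2}\right\rfloor$. If $g\ge \frac{2i^2-3i+1}{3}$ (equivalently, if $i\le \frac{3+\sqrt{24g+1}}{4}$) and if a graph $G$ embeds on a surface of Euler genus $g$, then $G$ has property $M(H(g)-i)$.
   Context: Graphs are finite, simple, with at least one vertex. A $k$-list assignment $L$ of a graph $G$ assigns to each vertex $v$ a set $L(v)$ of exactly $k$ colors. A proper $L$-list coloring is a map $c$ on $V(G)$ with $c(v)\in L(v)$ for all $v$ and $c(u)\ne c(v)$ for every edge $uv$. $G$ is uniquely $k$-list colorable (U$k$LC) if there exists a $k$-list assignment $L$ for which $G$ has exactly one proper $L$-list coloring. $G$ has property $M(k)$ if it is not uniquely $k$-list colorable. Surfaces are closed (compact, without boundary, connected), orientable or not; the Euler genus of a surface is $2$ minus its Euler characteristic, so that a 2-cell embedding on a surface of Euler genus $g$ satisfies $|V(G)|-|E(G)|+|F(G)|=2-g$. *)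

(* Defs.v *)
From HB Require Import structures.
From mathcomp Require Import all_boot all_order all_algebra.
From mathcomp Require Import all_classical all_reals all_analysis.

Set Implicit Arguments.
Unset Strict Implicit.
Unset Printing Implicit Defensive.

Import Order.TTheory GRing.Theory Num.Theory numFieldNormedType.Exports.

Local Open Scope classical_set_scope.
Local Open Scope ring_scope.

Definition simple_graph (V : finType) (e : rel V) : Prop :=
  [/\ symmetric e, irreflexive e & (0 < #|V|)%N].

Definition list_coloring (V : finType) (e : rel V) (C : finType)
    (L : V -> {set C}) (c : {ffun V -> C}) : Prop :=
  (forall v, c v \in L v) /\ (forall u v, e u v -> c u != c v).

(* Only finitely many colours occur in a list assignment of a finite graph,
   so it is enough to let the palette C range over the finite types. *)
Definition uniquely_list_colorable (V : finType) (e : rel V) (k : nat) : Prop :=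
  exists (C : finType) (L : V -> {set C}),
    (forall v, #|L v| = k) /\ exists! c : {ffun V -> C}, list_coloring e L c.

Definition property_M (V : finType) (e : rel V) (k : nat) : Prop :=
  ~ uniquely_list_colorable e k.

(* The maps are total; only their restrictions to A and B matter. *)
Definition homeomorphic (X Y : topologicalType) (A : set X) (B : set Y) : Prop :=
  exists (f : X -> Y) (h : Y -> X),
    [/\ (forall x, A x -> B (f x) /\ h (f x) = x),
        (forall y, B y -> A (h y) /\ f (h y) = y),
        {within A, continuous f} & {within B, continuous h}].

(* A compact locally Euclidean space is second countable, so the usual
   countability axiom for manifolds holds automatically. *)
Definition closed_surface (R : realType) (S : topologicalType) : Prop :=
  [/\ [set: S] !=set0, hausdorff_space S, compact [set: S], connected [set: S] &
      forall x : S, exists (U : set S) (W : set (R * R)),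
        [/\ open U, U x, open W & homeomorphic U W]].

(* A pure two-dimensional simplicial complex is given by the set K of its
   triangles; its simplices are the nonempty subsets of the triangles.
   Points of 'I_n lying in no triangle are not vertices of the complex. *)
Definition faces (n : nat) (K : {set {set 'I_n}}) (d : nat) : {set {set 'I_n}} :=
  [set s : {set 'I_n} | (#|s| == d.+1) && [exists t in K, s \subset t]]%SET.

(* Barycentric coordinates with support in a triangle. *)
Definition realization (R : realType) (n : nat) (K : {set {set 'I_n}}) :
    set 'rV[R]_n :=
  [set x : 'rV[R]_n | [/\ forall i, 0 <= x ord0 i, \sum_i x ord0 i = 1 &
    exists2 t, t \in K & forall i, x ord0 i != 0 -> i \in t]].

Definition euler_characteristic (n : nat) (K : {set {set 'I_n}}) : int :=
  #|faces K 0|%:Z - #|faces K 1|%:Z + #|faces K 2|%:Z.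

Definition share_edge_at (n : nat) (K : {set {set 'I_n}}) (i : 'I_n) :
    rel {set 'I_n} :=
  fun s t => [&& s \in K, t \in K, i \in s, i \in t & #|(s :&: t)%SET| == 2%N].

(* Every edge is in exactly two triangles, so the link of a vertex is a disjoint
   union of cycles; the last clause says that it is a single cycle. *)
Definition surface_complex (n : nat) (K : {set {set 'I_n}}) : Prop :=
  [/\ forall t, t \in K -> #|t| = 3%N,
      forall s, s \in faces K 1 -> #|[set t in K | s \subset t]%SET| = 2%N &
      forall (i : 'I_n) s t, s \in K -> t \in K -> i \in s -> i \in t ->
        connect (share_edge_at K i) s t].

(* Every closed surface has a finite triangulation, every triangulation of a
   closed surface satisfies surface_complex, and the Euler characteristic does
   not depend on the triangulation. *)
Definition has_euler_genus (R : realType) (S : topologicalType) (g : nat) : Prop :=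
  exists (n : nat) (K : {set {set 'I_n}}),
    [/\ surface_complex K, homeomorphic [set: S] (@realization R n K) &
        g%:Z = 2 - euler_characteristic K].

(* The embedding need not be 2-cell and the arcs need not be tame.
   The arc of the edge uv occurs as gamma u v and, reversed, as gamma v u. *)
Definition embeds_in (R : realType) (V : finType) (e : rel V)
    (S : topologicalType) : Prop :=
  exists (p : V -> S) (gamma : V -> V -> R -> S),
    [/\ injective p,
        forall u v, e u v ->
          [/\ {within `[0, 1], continuous (gamma u v)},
              {in `[0, 1] &, injective (gamma u v)},
              gamma u v 0 = p u, gamma u v 1 = p v &
              forall t : R, t \in `[0, 1] -> gamma v u t = gamma u v (1 - t)],
        forall u v w (t : R), e u v -> t \in `]0, 1[ -> gamma u v t <> p w &
        forall u v u' v' (t t' : R), e u v -> e u' v' ->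
          ([set u; v] != [set u'; v'])%SET ->
          t \in `]0, 1[ -> t' \in `]0, 1[ -> gamma u v t <> gamma u' v' t'].

(* The argument is positive, so Num.truncn is its floor. *)
Definition heawood (R : realType) (g : nat) : nat :=
  Num.truncn ((7 + Num.sqrt (24 * g%:R + 1)) / 2 : R).

(* Main.v *)
(** A uniquely colorable list assignment with lists of size k forces at least
    (k - 1) |V| edges: the product of all x_u - x_v over the edges uv vanishes on
    the whole grid of lists except at the unique coloring, so pairing it with
    functionals on the lists that kill the polynomials of degree < k - 1 gives a
    nonzero number, whereas every monomial of too small a degree would be killed
    at some vertex.  As the graph is simple, |V| >= 2 k - 1 follows.  This
    contradicts Euler's bound |E| <= 3 |V| + 3 g - 6 when k = H(g) - i.

    Euler's bound has to be proved for arcs that may be wild.  Cut every arc into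
    thirds: the outer thirds at v form a compact connected star, the middle
    thirds are compact connected bonds, and a star meets a bond only if they are
    incident.  In a fine enough iterated barycentric subdivision of the given
    triangulation, the vertices of the triangles that meet a star or a bond
    exhibit the graph as a minor of the 1-skeleton.  Now count modulo 2.  Give
    every edge of the graph an edge of the complex, its bridge, between the
    two branch sets.  The cocycles that vanish inside the branch sets take on the
    bridges at most |V| - 1 + g independent values (cuts, and g dimensions of
    cohomology), so by duality there are |E| - |V| + 1 - g independent edge sets
    that are the bridge part of a boundary.  They are spanned by the boundaries
    of the faces, the classes of triangles connected across edges that are neither
    inside a branch set nor bridges.  The face boundaries sum to zero, each edge is
    in at most two of them, and a nonzero one is an even subgraph, hence has at
    least three edges. *)

Require Import Defs.
From HB Require Import structures.
From mathcomp Require Import all_boot all_order all_algebra.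
From mathcomp Require Import all_classical all_reals all_analysis.
From mathcomp Require Import ring lra zify.

Set Implicit Arguments.
Unset Strict Implicit.
Unset Printing Implicit Defensive.

Import Order.TTheory GRing.Theory Num.Theory numFieldNormedType.Exports.

Local Open Scope ring_scope.

(** * Edges forced by a unique list coloring *)

Definition edge_set (V : finType) (e : rel V) : {set {set V}} :=
  [set s | [exists u, exists v, e u v && (s == [set u; v])]].

Lemma edge_setP (V : finType) (e : rel V) (s : {set V}) :
  reflect (exists u v, e u v /\ s = [set u; v]) (s \in edge_set e).
Proof.
rewrite inE; apply: (iffP existsP) => [[u /existsP[v /andP[euv /eqP ->]]]|].
  by exists u, v.
by move=> [u [v [euv ->]]]; exists u; apply/existsP; exists v; rewrite euv /=.
Qed.

Lemma mem_edge_set (V : finType) (e : rel V) u v :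
  e u v -> [set u; v] \in edge_set e.
Proof. by move=> euv; apply/edge_setP; exists u, v. Qed.

Lemma card_edge_set_le (V : finType) (e : rel V) : irreflexive e ->
  (#|edge_set e| <= 'C(#|V|, 2))%N.
Proof.
move=> eI; rewrite -card_draws subset_leq_card //; apply/fintype.subsetP => s.
move=> /edge_setP[u [v [euv ->]]]; rewrite inE cards2.
by have -> : u != v by apply: contraTneq euv => ->; rewrite eI.
Qed.

(** Divided-difference weights. A new node [b] divides each old weight by [x a - x b] and itself
    gets the weight that makes the total zero. As [x a = x b + (x a - x b)], the moment of order
    [j + 1] is [x b] times the moment of order [j] plus an old moment of order [j]. *)
Lemma dual_vandermonde (F : fieldType) (C : eqType) (x : C -> F) (a0 : C)
    (s : seq C) : injective x -> uniq (a0 :: s) ->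
  exists alpha : C -> F, alpha a0 != 0 /\
    forall j, (j < size s)%N -> \sum_(a <- a0 :: s) alpha a * x a ^+ j = 0.
Proof.
move=> xI; elim: s => [_|b s IHs].
  by exists (fun=> 1); rewrite oner_neq0.
rewrite [uniq _]/= inE negb_or -!andbA => /and4P[a0b a0s bs us].
have [|alpha [a0N0 al0]] := IHs; first by rewrite /= a0s us.
pose be a := alpha a / (x a - x b).
pose ga a := if a == b then - \sum_(a <- a0 :: s) be a else be a.
have gaE j : \sum_(a <- [:: a0, b & s]) ga a * x a ^+ j =
    \sum_(a <- a0 :: s) be a * (x a ^+ j - x b ^+ j).
  have -> : \sum_(a <- [:: a0, b & s]) ga a * x a ^+ j =
      ga b * x b ^+ j + \sum_(a <- a0 :: s) ga a * x a ^+ j.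
    by rewrite !big_cons addrCA.
  rewrite {1}/ga eqxx mulNr mulr_suml -sumrN -big_split /= !big_seq.
  apply: eq_bigr => a ain; rewrite /ga ifN; first by ring.
  move: ain; rewrite inE; apply: contraTneq => ->.
  by rewrite eq_sym (negPf a0b) (negPf bs).
exists ga; split.
  rewrite /ga (negPf a0b) mulf_neq0 // invr_eq0 subr_eq0.
  by apply: contra a0b => /eqP/xI ->.
elim=> [|j IHj] jlt.
  by rewrite gaE big1 // => a _; rewrite !expr0 subrr mulr0.
have -> : \sum_(a <- [:: a0, b & s]) ga a * x a ^+ j.+1 =
  x b * (\sum_(a <- [:: a0, b & s]) ga a * x a ^+ j) +
  \sum_(a <- a0 :: s) alpha a * x a ^+ j.
  rewrite !gaE mulr_sumr -big_split /= !big_seq; apply: eq_bigr => a ain.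
  have xab : x a - x b != 0.
    rewrite subr_eq0; apply: contraTneq ain => /xI ->.
    by rewrite inE eq_sym (negPf a0b) (negPf bs).
  by rewrite /be !exprS; field.
by rewrite IHj ?al0 ?mulr0 ?addr0 // ltnW.
Qed.

(** Expanding one factor [x (c u) - x (c w)] at a time raises the exponent of a single vertex by
    one. When no factor is left, the sum splits into a product over the vertices, and by the degree
    bound some vertex has exponent below [k v], so its factor vanishes. *)
Lemma sum_family_edge_product (V C : finType) (F : fieldType) (x : C -> F)
    (L : V -> {set C}) (k : V -> nat) (alpha : V -> C -> F) :
  (forall v j, (j < k v)%N -> \sum_(a in L v) alpha v a * x a ^+ j = 0) ->
  forall (es : seq (V * V)) (d : V -> nat),
  (size es + \sum_v d v < \sum_v k v)%N ->
  \sum_(c : {ffun V -> C} | c \in family (fun v => mem (L v)))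
     (\prod_v (alpha v (c v) * x (c v) ^+ d v)) *
     \prod_(p <- es) (x (c p.1) - x (c p.2)) = 0.
Proof.
move=> al0; elim=> [|[u w] es IHes] d.
  rewrite add0n => dlt.
  under eq_bigr do rewrite big_nil mulr1.
  rewrite -(bigA_distr_big_dep (fun v => mem (L v))
    (fun v a => alpha v a * x a ^+ d v)).
  have [v dv] : exists v, (d v < k v)%N.
    apply/existsP; apply: contraLR dlt; rewrite negb_exists -leqNgt => /forallP kd.
    by apply: leq_sum => v _; rewrite leqNgt kd.
  by rewrite (bigD1 v) //= (al0 v (d v)) // mul0r.
rewrite /= => lt_k.
pose d' z v := (d v + (v == z))%N.
have d'E z : (\sum_v d' z v = (\sum_v d v).+1)%N.
  rewrite big_split /= (bigD1 z (P := predT) (F := fun v => nat_of_bool (v == z))) //=.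
  by rewrite eqxx [X in (_ + (true + X))%N]big1 ?addn1 // => v /negPf ->.
have prodE z (c : {ffun V -> C}) : \prod_v (alpha v (c v) * x (c v) ^+ d' z v) =
    (\prod_v (alpha v (c v) * x (c v) ^+ d v)) * x (c z).
  rewrite (bigD1 z) // [in RHS](bigD1 z) //= /d' eqxx addn1 exprSr -!mulrA.
  congr (_ * (_ * _)); rewrite [RHS]mulrC; congr (_ * _).
  by apply: eq_bigr => v /negPf ->; rewrite addn0.
under eq_bigr => c _ do rewrite big_cons mulrA mulrBr mulrBl -!prodE.
by rewrite sumrB !IHes ?subrr // d'E addnS -addSn.
Qed.

Lemma unique_coloring_edges (V C : finType) (e : rel V) (L : V -> {set C}) k :
  (forall v, #|L v| = k.+1) ->
  (exists! c : {ffun V -> C}, list_coloring e L c) ->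
  (k * #|V| <= #|edge_set e|)%N.
Proof.
move=> Lk [c0 [[c0L c0e] c0U]]; rewrite leqNgt; apply/negP => ltE.
pose x (a : C) : rat := (enum_rank a)%:R.
have xI : injective x.
  by move=> a b /eqP; rewrite /x eqr_nat => /eqP /val_inj /enum_rank_inj.
(* The distinguished node at [v] is the color [c0 v]; the other [k] colors of the list are the
   remaining nodes, so degrees below [k] are killed. *)
have /choice[alpha al] : forall v, exists al : C -> rat, al (c0 v) != 0 /\
    forall j, (j < k)%N -> \sum_(a in L v) al a * x a ^+ j = 0.
  move=> v; have cin : c0 v \in enum (L v) by rewrite mem_enum.
  have pe := perm_to_rem cin.
  have us : uniq (c0 v :: rem (c0 v) (enum (L v))).
    by rewrite -(perm_uniq pe) enum_uniq.
  have [al [al0 alj]] := dual_vandermonde xI us; exists al; split=> // j jk.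
  rewrite -big_enum /= (perm_big _ pe) alj //.
  by rewrite size_rem // -cardE Lk.
have /choice[pq pqP] : forall s : {set V}, exists p : V * V,
    s \in edge_set e -> e p.1 p.2 /\ s = [set p.1; p.2].
  move=> s; have [/edge_setP[u [v uv]]|sN] := boolP (s \in edge_set e).
    by exists (u, v).
  (* Off the edge set any pair serves as a default; a vertex exists, since [ltE] fails for an empty
     [V]. *)
  have [v] : exists v : V, true.
    apply: contrapT => nV; move: ltE; rewrite ltnNge => /negP; apply.
    have -> : #|V| = 0%N by apply: eq_card0 => v; case: nV; exists v.
    by rewrite muln0.
  by exists (v, v).
pose es := [seq pq s | s <- enum (edge_set e)].
have := sum_family_edge_product (k := fun=> k) (fun v => (al v).2) (es := es)
  (d := fun=> 0%N).
rewrite size_map -cardE big1 // addn0 sum_nat_const mulnC ltE => /(_ isT).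
(* Only the term of [c0] survives: any other choice from the lists is improper, so one of its edge
   factors is zero. *)
apply/eqP; rewrite (bigD1 c0) /=; last exact/familyP.
rewrite [X in _ + X]big1 ?addr0 => [|c /andP[/familyP cL cc0]].
  rewrite mulf_neq0 //; first by apply/prodf_neq0 => v _; rewrite mulf_neq0 ?(al v).1.
  rewrite prodf_seq_neq0; apply/allP => p /mapP[s]; rewrite mem_enum => /pqP[ep _] ->.
  by rewrite subr_eq0 (inj_eq xI) c0e.
apply/eqP; rewrite mulf_eq0; apply/orP; right.
rewrite prodf_seq_eq0; apply: contraR cc0 => /hasPn ces; apply/eqP/esym/c0U.
split=> // u v euv; apply/negP => /eqP cuv.
have sE := mem_edge_set euv; have [epq spq] := pqP _ sE.
have /ces : pq [set u; v] \in es by apply/mapP; exists [set u; v]; rewrite ?mem_enum.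
rewrite /= subr_eq0 => /negP; apply; apply/eqP; congr x.
have /setP/[dup]/(_ u) := spq; rewrite !inE eqxx /= => /esym/orP uP /(_ v).
rewrite !inE eqxx orbT /= => /esym/orP vP.
have : u != v.
  apply: contraTneq euv => uv; apply/negP => euv.
  by have := c0e _ _ euv; rewrite uv eqxx.
by case: uP vP => /eqP <- [] /eqP <- //; rewrite eqxx.
Qed.

(** * Edge bound for minors of the 1-skeleton *)

Lemma linear_hom (K : fieldType) (aT rT : vectType K) (f : aT -> rT) :
  linear f -> exists g : 'Hom(aT, rT), g =1 f.
Proof.
move=> fl; pose fL : {linear aT -> rT} :=
  HB.pack f (GRing.isLinear.Build _ _ _ _ f fl).
by exists (linfun fL); exact: (lfunE fL).
Qed.

Lemma dim_limg_le (K : fieldType) (aT rT : vectType K) (f : 'Hom(aT, rT))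
    (U : {vspace aT}) : (\dim (f @: U) <= \dim U)%N.
Proof. by rewrite -(limg_ker_dim f U) leq_addl. Qed.

Lemma dim_ffun (K : fieldType) (I : finType) :
  \dim {:{ffun I -> K^o}} = #|I|.
Proof. by rewrite dimvf /dim /= muln1. Qed.

(** Split [U] into its part in the kernel of [g] and a complement, on which [g] is injective. *)
Lemma dim_limg_two (K : fieldType) (aT rT sT : vectType K)
    (f : 'Hom(aT, rT)) (g : 'Hom(aT, sT)) (U : {vspace aT}) :
  (\dim (f @: U) <= \dim (f @: (U :&: lker g)) + \dim (g @: U))%N.
Proof.
rewrite -{1}(addv_diff_cap U (lker g)) limgD addvC.
have := (dimv_add_leqif (f @: (U :&: lker g)) (f @: (U :\: lker g))).1.
move=> /leq_trans; apply; rewrite leq_add2l.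
apply: leq_trans (dim_limg_le _ _) _.
by rewrite -(leq_add2l (\dim (U :&: lker g))) dimv_cap_compl limg_ker_dim.
Qed.

(** Double orthogonality for the standard pairing: [z - projv U z] vanishes for [z] in [U], and each
    of its coordinates is the pairing of [z] with a fixed vector, so it vanishes at [x] as well. *)
Lemma memv_separated (K : fieldType) (I : finType)
    (U : {vspace {ffun I -> K^o}}) (x : {ffun I -> K^o}) :
  (forall f : {ffun I -> K^o},
     (forall u, u \in U -> \sum_i f i * u i = 0) -> \sum_i f i * x i = 0) ->
  x \in U.
Proof.
move=> orth; pose y := x - projv U x.
suff y0 : y = 0 by move/eqP: y0; rewrite subr_eq0 => /eqP ->; exact: memv_proj.
apply/ffunP => j; rewrite [RHS]ffunE.
pose del i : {ffun I -> K^o} := [ffun i' => (i' == i)%:R].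
have decomp (z : {ffun I -> K^o}) : z = \sum_i z i *: del i.
  apply/ffunP => i; rewrite sum_ffunE (bigD1 i) //= !ffunE eqxx.
  rewrite big1 ?addr0 => [|i' /negPf i'i].
    by rewrite /GRing.scale /= mulr1.
  by rewrite !ffunE eq_sym i'i /GRing.scale /= mulr0.
pose f : {ffun I -> K^o} := [ffun i => (del i - projv U (del i)) j].
have fE (z : {ffun I -> K^o}) : \sum_i f i * z i = (z - projv U z) j.
  rewrite {2 3}(decomp z) linear_sum -sumrB sum_ffunE; apply: eq_bigr => i _.
  by rewrite linearZ -scalerBr !ffunE mulrC.
rewrite /y -fE orth // => u uU.
by rewrite fE projv_id // subrr ffunE.
Qed.

(** [W] is the kernel of the pairing with a basis of [U], a map of rank at most the dimension of
    [U]. *)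
Lemma orthogonal_space (K : fieldType) (I : finType)
    (U : {vspace {ffun I -> K^o}}) :
  exists W : {vspace {ffun I -> K^o}}, (#|I| <= \dim W + \dim U)%N /\
    forall f : {ffun I -> K^o},
      f \in W <-> (forall u, u \in U -> \sum_i f i * u i = 0).
Proof.
pose b := vbasis U.
have [g gE] : exists g : 'Hom({ffun I -> K^o}, 'rV[K]_(\dim U)),
    g =1 (fun f => \row_j \sum_i f i * b`_j i).
  apply: linear_hom => a u v; apply/rowP => j; rewrite !mxE mulr_sumr -big_split.
  by apply: eq_bigr => i _; rewrite !ffunE mulrDl mulrA.
exists (lker g); split=> [|f].
  rewrite -(dim_ffun K) -(limg_ker_dim g) capfv leq_add2l.
  apply: leq_trans (dimvS (subvf _)) _.
  by rewrite dimvf /dim /= mul1n.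
rewrite memv_ker gE; split=> [/eqP/rowP f0 u uU|f0].
  rewrite (coord_vbasis uU).
  under eq_bigr do rewrite sum_ffunE mulr_sumr.
  rewrite exchange_big big1 // => j _; have := f0 j; rewrite !mxE => f0j.
  transitivity (coord (vbasis U) j u * \sum_i f i * b`_j i).
    by rewrite mulr_sumr; apply: eq_bigr => i _; rewrite ffunE mulrCA.
  by rewrite f0j mulr0.
apply/eqP/rowP => j; rewrite !mxE f0 // vbasis_mem //.
by rewrite mem_nth // size_tuple.
Qed.

Lemma addF2 (x : 'F_2) : x + x = 0.
Proof. by case: x => [[|[|n]]] nlt //; apply: val_inj. Qed.

Lemma oppF2 (x : 'F_2) : - x = x.
Proof. by apply/esym/eqP; rewrite -addr_eq0 addF2. Qed.

(** * Closed complexes and cochains modulo 2 *)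

Definition complex_edges (T : finType) (K : {set {set T}}) : {set {set T}} :=
  [set s : {set T} | (#|s| == 2) && [exists t in K, s \subset t]].

Definition closed_complex (T : finType) (K : {set {set T}}) : Prop :=
  (forall t, t \in K -> #|t| = 3%N) /\
  (forall s, s \in complex_edges K -> #|[set t in K | s \subset t]| = 2%N).

Definition cochain (T : finType) := {ffun {set T} -> ('F_2)^o}.

Definition cocycle (T : finType) (K : {set {set T}}) (f : cochain T) : Prop :=
  forall t, t \in K -> \sum_(s in complex_edges K | s \subset t) f s = 0.

Definition coboundary (T : finType) (K : {set {set T}}) (f : cochain T) : Prop :=
  exists h : T -> 'F_2, forall s, s \in complex_edges K -> f s = \sum_(v in s) h v.

(* The first cohomology group over 'F_2 has dimension at most g: g linear
   functionals separate the cocycles that are not coboundaries. *)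
Definition H1_le (T : finType) (K : {set {set T}}) (g : nat) : Prop :=
  exists Phi : 'Hom(cochain T, 'rV['F_2]_g),
    forall f, cocycle K f -> Phi f = 0 -> coboundary K f.

Lemma complex_edgesP (T : finType) (K : {set {set T}}) (s : {set T}) :
  reflect (exists a b t, [/\ a != b, s = [set a; b], t \in K, a \in t & b \in t])
    (s \in complex_edges K).
Proof.
apply: (iffP idP) => [|[a [b [t [ab -> tK at_ bt]]]]]; rewrite inE.
  move=> /andP[/cards2P[a [b [ab ->]]] /existsP[t /andP[tK]]].
  by rewrite finset.subUset !finset.sub1set => /andP[at_ bt]; exists a, b, t.
rewrite cards2 ab /=; apply/existsP; exists t.
by rewrite tK finset.subUset !finset.sub1set at_ bt.
Qed.

Lemma sum_triangle_edges (T : finType) (K : {set {set T}}) (M : nmodType)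
    (f : {set T} -> M) (a b c : T) : a != b -> a != c -> b != c ->
  [set a; b; c] \in K ->
  \sum_(s in complex_edges K | s \subset [set a; b; c]) f s =
  f [set a; b] + f [set a; c] + f [set b; c].
Proof.
move=> ab ac bc tK.
have nac : [set a; b] != [set a; c].
  apply/eqP => /setP/(_ b); rewrite !inE eqxx orbT (negPf bc) orbF.
  by rewrite eq_sym (negPf ab).
have nab : [set a; b] != [set b; c].
  by apply/eqP => /setP/(_ a); rewrite !inE eqxx (negPf ab) (negPf ac).
have ncb : [set a; c] != [set b; c].
  by apply/eqP => /setP/(_ a); rewrite !inE eqxx (negPf ab) (negPf ac).
rewrite (eq_bigl (mem ([set a; b] |: [set [set a; c]; [set b; c]]))) => [|s].
  rewrite big_setU1 /=; last by rewrite !inE negb_or nac.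
  by rewrite big_setU1 ?inE //= big_set1 addrA.
rewrite !inE -andbA; apply/idP/idP.
  move=> /and3P[/cards2P[x [y [xy ->]]] _]; rewrite finset.subUset !finset.sub1set !inE.
  move=> /andP[/orP[/orP[]|] /eqP xE /orP[/orP[]|] /eqP yE]; move: xy;
    rewrite {}xE {}yE ?eqxx // => _; rewrite ?orbT // finset.setUC eqxx ?orbT //.
move=> sE; have [x [y [xy -> xt yt]]] : exists x y,
    [/\ x != y, s = [set x; y], x \in [set a; b; c] & y \in [set a; b; c]].
  by case/orP: sE => [|/orP[]] /eqP ->; [exists a, b|exists a, c|exists b, c];
    rewrite !inE !eqxx ?orbT.
rewrite cards2 xy finset.subUset !finset.sub1set xt yt /= andbT.
by apply/existsP; exists [set a; b; c]; rewrite tK finset.subUset !finset.sub1set xt yt.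
Qed.

Lemma set3P (T : finType) (t : {set T}) : #|t| = 3%N ->
  exists a b c, [/\ a != b, a != c, b != c & t = [set a; b; c]].
Proof.
move=> t3; have [a at_] : exists a, a \in t by apply/card_gt0P; rewrite t3.
have /cards2P[b [c [bc tE]]] : #|t :\ a| == 2%N.
  by have := finset.cardsD1 a t; rewrite t3 at_ add1n => -[<-].
exists a, b, c; have [] : b \in t :\ a /\ c \in t :\ a by rewrite tE !inE !eqxx orbT.
rewrite !inE => /andP[ba _] /andP[ca _]; rewrite eq_sym ba eq_sym ca bc.
by split=> //; rewrite -finset.setUA -tE finset.setD1K.
Qed.

(** Each vertex of a triangle lies on two of its three edges. *)
Lemma coboundary_cocycle (T : finType) (K : {set {set T}}) (h : T -> 'F_2) t :
  t \in K -> #|t| = 3%N ->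
  \sum_(s in complex_edges K | s \subset t) \sum_(v in s) h v = 0.
Proof.
move=> tK /set3P[a [b [c [ab ac bc tE]]]]; rewrite {}tE in tK *.
rewrite sum_triangle_edges // !big_setU1 ?inE //= !big_set1.
rewrite [LHS](_ : _ = (h a + h a) + (h b + h b) + (h c + h c)); last by ring.
by rewrite !addF2.
Qed.

(** * Counting the faces of a minor modulo 2 *)

Section MinorBound.

Variables (T V I : finType) (K : {set {set T}}) (g : nat).
(** The vertices labelled [Some v] form the branch set of [v], and vertices labelled [None] lie in
    no branch set. [I] indexes the edges of the graph, with [bridge i] joining the branch sets of
    the two vertices in [ends i]. *)
Variables (lab : T -> option V) (ends : I -> {set V}) (bridge : I -> {set T}).
Hypothesis K_closed : closed_complex K.
Hypothesis V_gt0 : (0 < #|V|)%N.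
Hypothesis card_ends : forall i, #|ends i| = 2%N.
Hypothesis ends_inj : injective ends.
Hypothesis bridge_edge : forall i, bridge i \in complex_edges K.
Hypothesis lab_bridge : forall i, lab @: bridge i = Some @: ends i.

Let K3 t : t \in K -> #|t| = 3%N := K_closed.1 t.

Definition inner (s : {set T}) := [exists v, [forall a in s, lab a == Some v]].

Definition bdry (x : {set T} -> 'F_2) (s : {set T}) : 'F_2 :=
  \sum_(t in K | s \subset t) x t.

(** This is the coboundary of the indicator function of the branch set of [v]. *)
Definition at_label (v : V) (s : {set T}) : 'F_2 := \sum_(a in s) (lab a == Some v)%:R.

Lemma edge2 s : s \in complex_edges K -> exists a b, a != b /\ s = [set a; b].
Proof. by rewrite inE => /andP[/cards2P[a [b [ab ->]]] _]; exists a, b. Qed.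

Let SomeI : injective (@Some V). Proof. by move=> u v []. Qed.

Lemma bridge_inj : injective bridge.
Proof.
move=> i j ij; apply: ends_inj.
apply/setP => v.
by rewrite -(mem_imset (ends i) v SomeI) -lab_bridge ij lab_bridge (mem_imset _ _ SomeI).
Qed.

Lemma bridgeP i : exists a b u v, [/\ a != b, bridge i = [set a; b], u != v,
  ends i = [set u; v] & lab a = Some u /\ lab b = Some v].
Proof.
have [a [b [ab bE]]] := edge2 (bridge_edge i).
have /cards2P[u [v [uv eE]]] : #|ends i| == 2%N by rewrite card_ends.
have := lab_bridge i; rewrite bE eE !imsetU1 !imset_set1 => labE.
have uv' : Some u != Some v by apply: contra uv => /eqP[->].
have la : lab a \in [set Some u; Some v] by rewrite -labE !inE eqxx.
have lb : lab b \in [set Some u; Some v] by rewrite -labE !inE eqxx orbT.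
have nab : lab a != lab b.
  apply/eqP => lab_ab; have := f_equal (fun X : {set option V} => #|X|) labE.
  by rewrite !cards2 lab_ab eqxx uv'.
move: la lb; rewrite !inE => /orP[]/eqP la /orP[]/eqP lb.
- by rewrite la lb eqxx in nab.
- by exists a, b, u, v.
- by exists a, b, v, u; split=> //; [rewrite eq_sym|rewrite finset.setUC].
- by rewrite la lb eqxx in nab.
Qed.

Lemma inner_bridge i : ~~ inner (bridge i).
Proof.
have [a [b [u [v [ab -> uv _ [la lb]]]]]] := bridgeP i.
apply/existsP => -[w /forall_inP lw]; move: uv; apply/negP/negPn/eqP.
have := lw a; rewrite !inE eqxx la => /(_ isT)/eqP[->].
by have := lw b; rewrite !inE eqxx orbT lb => /(_ isT)/eqP[->].
Qed.

Lemma at_label_bridge i v : at_label v (bridge i) = (v \in ends i)%:R.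
Proof.
have [a [b [u [w [ab -> uw -> [la lb]]]]]] := bridgeP i.
rewrite /at_label big_setU1 ?inE //= big_set1 la lb.
rewrite !(inj_eq SomeI) ![v == _]eq_sym.
have [<-|_] := eqVneq u v; last by rewrite add0r.
by rewrite eq_sym (negPf uw) addr0.
Qed.

Lemma at_label_inner s v : s \in complex_edges K -> inner s -> at_label v s = 0.
Proof.
move=> /edge2[a [b [ab ->]]] /existsP[w /forall_inP lw].
rewrite /at_label big_setU1 ?inE //= big_set1.
rewrite (eqP (lw a _)) ?inE ?eqxx // (eqP (lw b _)) ?inE ?eqxx ?orbT //.
exact: addF2.
Qed.

(** Pair the boundary of [x] with the cocycle [at_label v]: the result is zero. Inner edges drop out
    because [at_label v] vanishes there, the other non-bridges because the boundary does, and the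
    bridges at [v] remain. *)
Lemma bdry_parity x v :
  (forall s, s \in complex_edges K -> ~~ inner s -> s \notin codom bridge ->
     bdry x s = 0) ->
  \sum_(i | v \in ends i) bdry x (bridge i) = 0.
Proof.
move=> x0.
transitivity (\sum_(s in complex_edges K) at_label v s * bdry x s).
  rewrite [RHS](bigID (mem (bridge @: [set: I]))) /= [X in _ = _ + X]big1 ?addr0.
    rewrite [RHS](eq_bigl (mem (bridge @: [set: I]))) => [|s /=]; last first.
      rewrite andb_idl // => /imsetP[i _ ->]; exact: bridge_edge.
    rewrite [RHS]big_imset /=; last by move=> i j _ _; exact: bridge_inj.
    rewrite [LHS]big_mkcond; apply: eq_big => [i|i _]; first by rewrite inE.
    by rewrite at_label_bridge; case: ifP; rewrite ?mul1r ?mul0r.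
  move=> s /andP[sK snb]; have [ins|nins] := boolP (inner s).
    by rewrite at_label_inner // mul0r.
  rewrite x0 ?mulr0 //; apply: contra snb => /codomP[i ->].
  exact: imset_f.
rewrite /bdry; under eq_bigr do rewrite big_distrr /=.
rewrite (exchange_big_dep (mem K)) /= => [|s t _ /andP[]//].
rewrite big1 // => t tK.
transitivity ((\sum_(s in complex_edges K | s \subset t) at_label v s) * x t).
  by rewrite mulr_suml; apply: eq_bigl => s; rewrite tK.
by rewrite coboundary_cocycle ?mul0r // K3.
Qed.

(** An edge in the support needs a second one at each of its two ends; these two differ from each
    other because the graph has no parallel edges. *)
Lemma even_support (m : I -> 'F_2) i0 :
  (forall v, \sum_(i | v \in ends i) m i = 0) -> m i0 != 0 ->
  (3 <= #|[set i | (m i != 0)%R]|)%N.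
Proof.
move=> m_even mi0.
have other v : v \in ends i0 -> exists i, [/\ i != i0, v \in ends i & m i != 0].
  move=> vi0; apply: contrapT => nex; move: mi0; apply/negP/negPn/eqP.
  rewrite -[RHS](m_even v) (bigD1 i0) //= big1 ?addr0 // => i /andP[vi ii0].
  by apply/eqP/negPn/negP => mi; apply: nex; exists i.
have [a [b [u [v [_ _ uv e0 _]]]]] := bridgeP i0.
have [|i1 [i10 ui1 mi1]] := other u; first by rewrite e0 !inE eqxx.
have [|i2 [i20 vi2 mi2]] := other v; first by rewrite e0 !inE eqxx orbT.
have i12 : i1 != i2.
  apply: contra i10 => /eqP i12; apply/eqP/ends_inj/esym/eqP.
  by rewrite eqEcard !card_ends e0 finset.subUset !finset.sub1set ui1 i12 vi2.
have <- : #|[set i0; i1; i2]| = 3%N.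
  rewrite -finset.setUA cardsU1 cards2 i12 !inE negb_or.
  by rewrite eq_sym i10 eq_sym i20.
apply: subset_leq_card; apply/fintype.subsetP => i; rewrite !inE.
by case/orP => [/orP[]|] /eqP ->.
Qed.

Hypothesis K_H1 : H1_le K g.
Hypothesis lab_connected : forall v a b, lab a = Some v -> lab b = Some v ->
  connect (fun x y => [&& [set x; y] \in complex_edges K, lab x == Some v &
    lab y == Some v]) a b.

(** A potential whose coboundary vanishes on inner edges is constant on each connected branch set,
    hence descends to the vertices of the graph. *)
Lemma cut_space (f : cochain T) : coboundary K f ->
  (forall s, s \in complex_edges K -> inner s -> f s = 0) ->
  exists h : V -> 'F_2, forall i, f (bridge i) = \sum_(v in ends i) h v.
Proof.
move=> [h fE] f0.
have hconst v a b : lab a = Some v -> lab b = Some v -> h a = h b.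
  move=> la lb; have /connectP[p pp ->] := lab_connected la lb.
  elim: p a {la} pp => [//|c p IHp] a /= /andP[/and3P[acK la lc] pp].
  rewrite -(IHp c pp); have /fE := acK.
  have ac : a != c by move: acK; rewrite inE cards2; case: (a != c).
  rewrite big_setU1 ?inE //= big_set1 f0 //.
    by move=> hac; rewrite -[LHS]addr0 hac addrA addF2 add0r.
  apply/existsP; exists v; apply/forall_inP => z.
  by rewrite !inE => /orP[] /eqP ->.
(* An empty branch set gets the default 0, which no bridge sees. *)
exists (fun v => if [pick a | lab a == Some v] is Some a then h a else 0) => i.
have [a [b [u [v [ab bE uv eE [la lb]]]]]] := bridgeP i.
have pickE w c : lab c = Some w ->
  (if [pick a | lab a == Some w] is Some a then h a else 0) = h c.
  move=> lc; case: pickP => [c' /eqP lc'|/(_ c)]; first exact: hconst lc' lc.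
  by rewrite lc eqxx.
rewrite fE ?bridge_edge // bE eE !big_setU1 ?inE //= !big_set1.
by rewrite (pickE _ _ la) (pickE _ _ lb).
Qed.

(** Cuts are the image of the functions on [V], and the nonzero constant function is in the
    kernel. *)
Lemma dim_cuts (R : {vspace {ffun I -> ('F_2)^o}}) :
  (forall r, r \in R -> exists h : V -> 'F_2, forall i, r i = \sum_(v in ends i) h v) ->
  (\dim R < #|V|)%N.
Proof.
move=> Rcut.
have [d dE] : exists d : 'Hom({ffun V -> ('F_2)^o}, {ffun I -> ('F_2)^o}),
    d =1 (fun h => [ffun i => \sum_(v in ends i) h v]).
  apply: linear_hom => a u v; apply/ffunP => i; rewrite !ffunE.
  rewrite [RHS](_ : _ = a * (\sum_(v in ends i) u v) + \sum_(w in ends i) v w) //.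
  by rewrite mulr_sumr -big_split; apply: eq_bigr => w _; rewrite !ffunE.
have /dimvS : (R <= limg d)%VS.
  apply/subvP => r /Rcut[h rE]; have -> : r = d [ffun v => h v].
    apply/ffunP => i; rewrite dE ffunE rE.
    by apply: eq_bigr => v _; rewrite ffunE.
  by rewrite memv_img ?memvf.
move/leq_ltn_trans; apply; rewrite -(dim_ffun 'F_2 V) -(limg_ker_dim d) capfv.
rewrite -[X in (X < _)%N]add0n ltn_add2r lt0n dimv_eq0.
have : ([ffun=> 1] : {ffun V -> ('F_2)^o}) \in lker d.
  rewrite memv_ker dE; apply/eqP/ffunP => i; rewrite !ffunE.
  have [a [b [u [v [_ _ uv -> _]]]]] := bridgeP i.
  by rewrite big_setU1 ?inE //= big_set1 !ffunE; apply: addF2.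
apply: contraTneq => ->; rewrite memv0; apply/eqP => /ffunP.
by have /card_gt0P[v _] := V_gt0 => /(_ v); rewrite !ffunE.
Qed.

(* W is the orthogonal complement of the values on the bridges of the cocycles
   vanishing inside the label classes.  For w in W, the chain of bridges with
   coefficients w is orthogonal to all these cocycles, so it is a boundary up to a
   chain inside the label classes. *)
Lemma bounding_space : exists W : {vspace {ffun I -> ('F_2)^o}},
  (#|I| < \dim W + #|V| + g)%N /\
  forall w, w \in W -> exists x : {set T} -> 'F_2,
    (forall s, s \in complex_edges K -> ~~ inner s -> s \notin codom bridge ->
       bdry x s = 0) /\
    (forall i, bdry x (bridge i) = w i).
Proof.
have [Phi PhiP] := K_H1.
have [D DE] : exists D : 'Hom(cochain T, cochain T),
    D =1 (fun x => [ffun s => bdry x s]).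
  apply: linear_hom => a u v; apply/ffunP => s; rewrite !ffunE.
  rewrite [RHS](_ : _ = a * bdry u s + bdry v s) // /bdry mulr_sumr -big_split.
  by apply: eq_bigr => t _; rewrite !ffunE.
(* [Z] is where a correction is free: the inner edges, and all sets that are not edges, on which [D]
   takes meaningless values. *)
pose Z := [pred s : {set T} | inner s || (s \notin complex_edges K)].
have [J JE] : exists J : 'Hom(cochain T, cochain T),
    J =1 (fun x => [ffun s => if Z s then x s else 0]).
  apply: linear_hom => a u v; apply/ffunP => s; rewrite !ffunE.
  by case: ifP => _ //; rewrite scaler0 addr0.
have [Psi PsiE] : exists Psi : 'Hom(cochain T, {ffun I -> ('F_2)^o}),
    Psi =1 (fun f => [ffun i => f (bridge i)]).
  by apply: linear_hom => a u v; apply/ffunP => s; rewrite !ffunE.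
(* A vector orthogonal to [U] is a cocycle that vanishes on [Z]; [P] is the space of these. *)
pose U := (limg D + limg J)%VS.
have [P [_ PE]] := orthogonal_space U.
pose del (t : {set T}) : cochain T := [ffun t' => (t' == t)%:R].
have P0 f s : f \in P -> Z s -> f s = 0.
  move=> /PE fU Zs; have : J (del s) \in U.
    by apply: (subvP (addvSr _ _)); rewrite memv_img ?memvf.
  move=> /fU <-; rewrite (bigD1 s) //= big1 => [|s' /negPf s's].
    by rewrite JE !ffunE Zs eqxx mulr1 addr0.
  by rewrite JE !ffunE s's if_same mulr0.
have Pcocycle f : f \in P -> cocycle K f.
  move=> fP t tK; move: (fP) => /PE fU; have : D (del t) \in U.
    by apply: (subvP (addvSl _ _)); rewrite memv_img ?memvf.
  move=> /fU; apply: etrans; rewrite [RHS](bigID (fun s => (s \in complex_edges K) && (s \subset t))) /=.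
  rewrite [X in _ + X]big1 ?addr0 => [|s].
    apply: eq_bigr => s /andP[_ st]; rewrite DE ffunE /bdry (bigD1 t) ?tK //=.
    rewrite ffunE eqxx big1 ?addr0 ?mulr1 // => t' /andP[_ /negPf t't].
    by rewrite ffunE t't.
  rewrite negb_and => /orP[sN|st].
    by rewrite (P0 f s fP) ?mul0r //= sN orbT.
  rewrite DE ffunE /bdry big1 ?mulr0 // => t' /andP[_ st'].
  by rewrite ffunE; case: eqP st => // <-; rewrite st'.
(* On the part of [P] where [Phi] vanishes the bridge values are cuts; [Phi] accounts for at most
   [g] further dimensions. *)
have dimR : (\dim (Psi @: P) < #|V| + g)%N.
  apply: leq_ltn_trans (dim_limg_two Psi Phi P) _.
  rewrite -addSn leq_add //; last first.
    by apply: leq_trans (dimvS (subvf _)) _; rewrite dimvf /dim /= mul1n.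
  apply: dim_cuts => r /memv_imgP[f /[!memv_cap]/andP[fP /[!memv_ker]/eqP Phif] ->].
  have [||h hE] := @cut_space f.
  - exact: PhiP (Pcocycle _ fP) Phif.
  - by move=> s _ ins; apply: P0 => //=; rewrite ins.
  by exists h => i; rewrite PsiE ffunE.
have [W [dimW WE]] := orthogonal_space (Psi @: P).
exists W; split=> [|w /WE wR].
  by apply: leq_ltn_trans dimW _; rewrite -addnA ltn_add2l.
(* The chain of bridges with coefficients [w] is orthogonal to [P], hence lies in [U]: a boundary
   plus a chain on [Z]. *)
pose z : cochain T := [ffun s => \sum_i w i * (s == bridge i)%:R].
have : z \in U.
  apply: memv_separated => f /PE fP.
  transitivity (\sum_i w i * (Psi f) i); last by apply: wR; rewrite memv_img.
  under eq_bigr do rewrite ffunE mulr_sumr.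
  rewrite exchange_big; apply: eq_bigr => i _.
  rewrite (bigD1 (bridge i)) //= eqxx big1 => [|s /negPf ->].
    by rewrite PsiE ffunE mulr1 addr0 mulrC.
  by rewrite !mulr0.
move=> /memv_addP[_ /memv_imgP[x _ ->] [_ /memv_imgP[y _ ->]]] /ffunP zE.
have {}zE s : s \in complex_edges K -> ~~ inner s -> bdry x s = \sum_i w i * (s == bridge i)%:R.
  move=> sK ins; have := zE s; rewrite !ffunE DE JE !ffunE /=.
  by rewrite (negPf ins) sK addr0.
exists x; split=> [s sK ins sN|i].
  rewrite zE // big1 // => i _; case: eqP => [sE|_]; last by rewrite mulr0.
  by rewrite sE codom_f in sN.
rewrite zE ?bridge_edge ?inner_bridge // (bigD1 i) //= eqxx mulr1 big1 ?addr0 //.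
by move=> j /negPf ji; rewrite (inj_eq bridge_inj) eq_sym ji mulr0.
Qed.

Lemma bdry2 s : s \in complex_edges K -> exists t1 t2,
  [/\ t1 != t2, [set t in K | s \subset t] = [set t1; t2] &
      forall x, bdry x s = x t1 + x t2].
Proof.
move=> sK; have /eqP/cards2P[t1 [t2 [t12 E]]] := K_closed.2 s sK.
exists t1, t2; split=> // x.
transitivity (\sum_(t in [set t1; t2]) x t).
  by rewrite -E; apply: eq_bigl => t; rewrite inE.
by rewrite big_setU1 ?inE //= big_set1.
Qed.

Definition face_adj : rel {set T} := fun t t' => [&& t \in K, t' \in K &
  [exists s in complex_edges K, [&& ~~ inner s, s \notin codom bridge,
     s \subset t & s \subset t']]].

Lemma face_adj_sym : symmetric face_adj.
Proof.
move=> t t'; rewrite /face_adj andbCA; congr [&& _, _ & _].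
by apply: eq_existsb => s; rewrite (andbC (s \subset t)).
Qed.

(** Modulo 2, a zero boundary at an edge means equal coefficients on its two triangles. *)
Lemma bdry0_face_adj x : (forall s, s \in complex_edges K -> ~~ inner s ->
  s \notin codom bridge -> bdry x s = 0) -> forall t t', face_adj t t' -> x t = x t'.
Proof.
move=> x0 t t' /and3P[tK t'K /exists_inP[s sK /and4P[ins sN st st']]].
have [t1 [t2 [_ E xE]]] := bdry2 sK.
have : t \in [set t1; t2] by rewrite -E inE tK.
have : t' \in [set t1; t2] by rewrite -E inE t'K.
have x12 : x t1 = x t2.
  by rewrite -[LHS]addr0 -(addF2 (x t2)) addrA -xE x0 ?add0r.
by rewrite !inE => /orP[] /eqP -> /orP[] /eqP ->.
Qed.

Definition face (t : {set T}) : {set T} := fingraph.root face_adj t.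

(** A face is named by its root triangle. The index [j] runs over all sets; one that is not the root
    of a face made of triangles of [K] gets the zero boundary. *)
Definition face_bdry (j : {set T}) : {ffun I -> ('F_2)^o} :=
  [ffun i => bdry (fun t => (face t == j)%:R) (bridge i)].

Lemma face_eq t t' : face_adj t t' -> face t = face t'.
Proof.
by move=> tt'; apply/eqP; rewrite root_connect ?connect1 //;
  apply/sym_connect_sym/face_adj_sym.
Qed.

Lemma face_bdry_even j v : \sum_(i | v \in ends i) face_bdry j i = 0.
Proof.
under eq_bigr do rewrite ffunE; apply: bdry_parity => s sK ins sN.
have [t1 [t2 [_ E ->]]] := bdry2 sK.
have [[t1K st1] [t2K st2]] : (t1 \in K /\ s \subset t1) /\ (t2 \in K /\ s \subset t2).
  have H t : t \in [set t1; t2] -> t \in K /\ s \subset t.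
    by rewrite -E inE => /andP[].
  by split; apply: H; rewrite !inE eqxx ?orbT.
rewrite (@face_eq t1 t2) ?addF2 // /face_adj t1K t2K /=.
by apply/exists_inP; exists s; rewrite // ins sN st1.
Qed.

Definition real_faces := [set j | face_bdry j != 0].

(** Double counting: a nonzero face boundary has at least three bridges by [even_support], and a
    bridge occurs only for the faces of its two triangles. *)
Lemma card_real_faces : (3 * #|real_faces| <= 2 * #|I|)%N.
Proof.
apply: (@leq_trans (\sum_(j in real_faces) \sum_i (face_bdry j i != 0)%R)%N).
  rewrite mulnC -sum_nat_const; apply: leq_sum => j; rewrite inE => jN0.
  have [i mi] : exists i, face_bdry j i != 0.
    apply/existsP; apply: contraNT jN0; rewrite negb_exists => /forallP m0.
    by apply/eqP/ffunP => i; rewrite [RHS]ffunE; apply/eqP; have := m0 i; rewrite negbK.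
  have := even_support (face_bdry_even j) mi.
  by rewrite -sum1_card big_mkcond /=; under eq_bigr do rewrite inE.
rewrite exchange_big mulnC -sum_nat_const; apply: leq_sum => i _.
have [t1 [t2 [_ _ E]]] := bdry2 (bridge_edge i).
rewrite -big_mkcondr sum1_card.
apply: (@leq_trans #|[set face t1; face t2]|); last by rewrite cards2; case: (_ != _).
apply: subset_leq_card; apply/fintype.subsetP => j /andP[_].
rewrite ffunE E !inE ![j == _]eq_sym; apply: contraNT; rewrite negb_or.
by move=> /andP[/negPf -> /negPf ->]; rewrite addr0.
Qed.

(** Each of the two triangles at a bridge belongs to exactly one face, so the bridge is counted
    twice. *)
Lemma sum_real_faces : \sum_(j in real_faces) face_bdry j = 0.
Proof.
apply/ffunP => i; rewrite sum_ffunE [RHS]ffunE.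
rewrite -[RHS](addF2 1); have [t1 [t2 [_ _ E]]] := bdry2 (bridge_edge i).
transitivity (\sum_j face_bdry j i).
  rewrite [RHS](bigID (mem real_faces)) /= [X in _ + X]big1 ?addr0 // => j.
  by rewrite inE negbK => /eqP ->; rewrite ffunE.
under eq_bigr do rewrite ffunE E; rewrite big_split /=.
have sum1 t : \sum_j (face t == j)%:R = 1 :> 'F_2.
  rewrite (bigD1 (face t)) //= eqxx big1 ?addr0 // => j /negPf.
  by rewrite eq_sym => ->.
by rewrite !sum1.
Qed.

(** If all face boundaries are zero, then [W] is zero, which is the first alternative. Otherwise,
    with f nonzero face boundaries, [W] has dimension at most f - 1 and 3 f <= 2 [#|I|]; inserted in
    [#|I| < \dim W + #|V| + g], this gives the second. *)
Theorem minor_edge_bound :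
  (#|I| < #|V| + g)%N \/ (#|I| + 6 <= 3 * (#|V| + g))%N.
Proof.
have [W [dimW WE]] := bounding_space.
have Wspan w : w \in W -> exists x : {set T} -> 'F_2,
    w = \sum_(j in real_faces) x j *: face_bdry j.
  move=> /WE[x [x0 xE]]; exists x.
  (* A chain bounding only inner edges and bridges is constant on each face, hence a combination of
     faces. *)
  have xface t : x t = x (face t).
    rewrite /face; have /connectP[p pp ->] := connect_root face_adj t.
    elim: p t pp => [//|t' p IHp] t /= /andP[tt' pp].
    by rewrite (bdry0_face_adj x0 tt') IHp.
  apply/ffunP => i; rewrite -xE sum_ffunE.
  transitivity (\sum_j x j * face_bdry j i).
    have [t1 [t2 [_ _ E]]] := bdry2 (bridge_edge i).
    under [RHS]eq_bigr do rewrite ffunE E mulrDr.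
    rewrite E big_split /= (xface t1) (xface t2).
    have sum1 t : \sum_j x j * (face t == j)%:R = x (face t).
      rewrite (bigD1 (face t)) //= eqxx mulr1 big1 ?addr0 // => j /negPf.
      by rewrite eq_sym => ->; rewrite mulr0.
    by rewrite !sum1.
  rewrite (bigID (mem real_faces)) /= [X in _ + X]big1 ?addr0 => [|j].
    by apply: eq_bigr => j _; rewrite [in RHS]ffunE.
  by rewrite inE negbK => /eqP ->; rewrite ffunE mulr0.
have [faces0|[j0 j0in]] := set_0Vmem real_faces.
  left; have W0 : W = 0%VS.
    apply/eqP; rewrite -subv0; apply/subvP => w /Wspan[x ->].
    by rewrite faces0 big_set0 mem0v.
  by move: dimW; rewrite W0 dimv0.
(* The relation [sum_real_faces] expresses the boundary of [j0] through the others and saves one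
   dimension. *)
right; have dimW' : (\dim W < #|real_faces|)%N.
  rewrite (finset.cardsD1 j0) j0in add1n ltnS cardE -(size_map face_bdry).
  apply: leq_trans (dim_span _); apply: dimvS; apply/subvP => w /Wspan[x ->].
  have face_in j : j \in real_faces :\ j0 ->
      face_bdry j \in <<[seq face_bdry j | j <- enum (real_faces :\ j0)]>>%VS.
    by move=> jin; apply/memv_span/map_f; rewrite mem_enum.
  apply: rpred_sum => j jin; apply: rpredZ.
  have [->|jj0] := eqVneq j j0; last by apply: face_in; rewrite finset.in_setD1 jj0.
  have := sum_real_faces; rewrite (bigD1 j0) //= => /eqP.
  rewrite addr_eq0 => /eqP ->; rewrite rpredN; apply: rpred_sum => k /andP[kin kj0].
  by apply: face_in; rewrite finset.in_setD1 kj0.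
have := card_real_faces; lia.
Qed.

End MinorBound.

(** * Barycentric subdivision *)

Definition chain (T : finType) (s1 s2 s3 : {set T}) : {set {set T}} := [set s1; s2; s3].

Definition is_chain (T : finType) (K : {set {set T}}) (s1 s2 s3 : {set T}) :=
  [&& #|s1| == 1%N, #|s2| == 2%N, s3 \in K, s1 \subset s2 & s2 \subset s3].

Definition barycentric (T : finType) (K : {set {set T}}) : {set {set {set T}}} :=
  [set F | [exists s1, exists s2, exists s3,
     is_chain K s1 s2 s3 && (F == chain s1 s2 s3)]].

Section Barycentric.

Variables (T : finType) (K : {set {set T}}).
Hypothesis K_closed : closed_complex K.

Lemma barycentricP F : reflect
  (exists s1 s2 s3, is_chain K s1 s2 s3 /\ F = chain s1 s2 s3) (F \in barycentric K).
Proof.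
rewrite inE; apply: (iffP existsP) => [[s1 /existsP[s2 /existsP[s3 /andP[h /eqP ->]]]]|].
  by exists s1, s2, s3.
move=> [s1 [s2 [s3 [h ->]]]]; exists s1; apply/existsP; exists s2; apply/existsP.
by exists s3; rewrite h /=.
Qed.

Lemma chain_barycentric s1 s2 s3 :
  is_chain K s1 s2 s3 -> chain s1 s2 s3 \in barycentric K.
Proof. by move=> h; apply/barycentricP; exists s1, s2, s3. Qed.

Lemma chain_card s1 s2 s3 : is_chain K s1 s2 s3 ->
  [/\ #|s1| = 1%N, #|s2| = 2%N & #|s3| = 3%N].
Proof. by move=> /and5P[/eqP -> /eqP -> /K_closed.1 ->]. Qed.

Lemma chain_neq s1 s2 s3 : is_chain K s1 s2 s3 ->
  [/\ s1 != s2, s1 != s3 & s2 != s3].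
Proof.
move=> /chain_card[c1 c2 c3].
by split; apply/eqP => E; congruence.
Qed.

Lemma chain_mem s1 s2 s3 s : is_chain K s1 s2 s3 -> s \in chain s1 s2 s3 ->
  [/\ #|s| = 1%N -> s = s1, #|s| = 2%N -> s = s2 & #|s| = 3%N -> s = s3].
Proof.
move=> /chain_card[c1 c2 c3]; rewrite !inE => /orP[/orP[]|] /eqP ->.
- by rewrite c1.
- by rewrite c2.
- by rewrite c3.
Qed.

Lemma chainP s1 s2 s3 : is_chain K s1 s2 s3 -> exists a b c,
  [/\ [/\ a != b, a != c & b != c], s1 = [set a], s2 = [set a; b],
      s3 = [set a; b; c] & s3 \in K].
Proof.
move=> /[dup] /chain_card[c1 c2 c3] /and5P[_ _ s3K s12 s23].
have /cards1P[a s1E] : #|s1| == 1%N by rewrite c1.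
have a2 : a \in s2 by apply: (fintype.subsetP s12); rewrite s1E inE.
have /cards1P[b s2E] : #|s2 :\ a| == 1%N.
  by have := finset.cardsD1 a s2; rewrite c2 a2 add1n => -[<-].
have {}s2E : s2 = [set a; b] by rewrite -(finset.setD1K a2) s2E.
have ab : a != b by move: c2; rewrite s2E cards2; case: (a != b).
have a3 : a \in s3 by apply: (fintype.subsetP s23); rewrite s2E !inE eqxx.
have b3 : b \in s3 by apply: (fintype.subsetP s23); rewrite s2E !inE eqxx orbT.
have /cards1P[c s3E] : #|s3 :\ a :\ b| == 1%N.
  have := finset.cardsD1 a s3; rewrite c3 a3 add1n => -[E].
  have := finset.cardsD1 b (s3 :\ a); rewrite -E finset.in_setD1 b3 eq_sym ab add1n.
  by move=> -[<-].
have cin : c \in s3 :\ a :\ b by rewrite s3E inE.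
exists a, b, c; split=> //.
  by move: cin; rewrite !inE ![c == _]eq_sym => /and3P[-> -> _].
rewrite -finset.setUA -s3E -[RHS]/(a |: (b |: _)).
by rewrite finset.setD1K ?finset.setD1K // finset.in_setD1 b3 eq_sym ab.
Qed.

Lemma is_chain_abc a b c : a != b -> [set a; b; c] \in K ->
  is_chain K [set a] [set a; b] [set a; b; c].
Proof.
move=> ab tK; rewrite /is_chain cards1 cards2 ab tK /= finset.subsetUl.
by rewrite finset.subsetUl.
Qed.

Lemma barycentric_edge s : s \in complex_edges (barycentric K) ->
  exists s1 s2 s3, is_chain K s1 s2 s3 /\
    [\/ s = [set s1; s2], s = [set s1; s3] | s = [set s2; s3]].
Proof.
move=> /complex_edgesP[x [y [F [xy -> /barycentricP[s1 [s2 [s3 [h ->]]]] xF yF]]]].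
exists s1, s2, s3; split=> //; move: xy xF yF; rewrite !inE.
move=> xy /orP[/orP[]|] /eqP xE /orP[/orP[]|] /eqP yE; move: xy; rewrite xE yE ?eqxx // => _.
- exact: Or31.
- exact: Or32.
- by rewrite finset.setUC; apply: Or31.
- exact: Or33.
- by rewrite finset.setUC; apply: Or32.
- by rewrite finset.setUC; apply: Or33.
Qed.

Lemma card_barycentric_cofaces (s : {set {set T}}) (A : {set {set T}})
    (c : {set T} -> {set {set T}}) :
  {in A &, injective c} -> #|A| = 2%N ->
  (forall F, (F \in barycentric K) && (s \subset F) = (F \in c @: A)) ->
  #|[set F in barycentric K | s \subset F]| = 2%N.
Proof.
move=> cI A2 cE; rewrite -A2 -(card_in_imset cI).
by apply: eq_card => F; rewrite inE cE.
Qed.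

(** An edge of the subdivision is a flag with one member missing, and there are two ways to complete
    it: the two triangles at an edge, the two edges of a triangle at a vertex, or the two ends of an
    edge. *)
Lemma barycentric_closed : closed_complex (barycentric K).
Proof.
split=> [F /barycentricP[s1 [s2 [s3 [h ->]]]]|s].
  have [n12 n13 n23] := chain_neq h.
  by rewrite /chain -finset.setUA cardsU1 cards2 n23 !inE negb_or n12 n13.
move=> /barycentric_edge[s1 [s2 [s3 [h sE]]]].
have [c1 c2 c3] := chain_card h; have /and5P[_ _ s3K s12 s23] := h.
have [a [b [c [[ab ac bc] s1E s2E s3E _]]]] := chainP h.
case: sE => {s}->.
- apply: (@card_barycentric_cofaces _ [set t | is_chain K s1 s2 t] (chain s1 s2)).
  + move=> t t'; rewrite !inE => ht ht' E.
    have [_ _ c3t] := chain_card ht.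
    have : t \in chain s1 s2 t' by rewrite -E !inE eqxx orbT.
    by move/(chain_mem ht') => [_ _ /(_ c3t)].
  + rewrite -(K_closed.2 s2).
      by apply: eq_card => t; rewrite !inE /is_chain c1 c2 s12.
    by apply/complex_edgesP; exists a, b, s3; rewrite s2E s3E !inE !eqxx orbT -s3E.
  + move=> F; apply/andP/imsetP => [[/barycentricP[x1 [x2 [x3 [hx ->]]]]]|[t]].
      rewrite finset.subUset !finset.sub1set => /andP[/(chain_mem hx)[/(_ c1) e1 _ _]].
      by move=> /(chain_mem hx)[_ /(_ c2) e2 _]; exists x3; rewrite e1 e2 // inE.
    rewrite inE => ht ->; split; first exact: chain_barycentric.
    by rewrite finset.subUset !finset.sub1set !inE !eqxx orbT.
- apply: (@card_barycentric_cofaces _ [set t | is_chain K s1 t s3] (fun t => chain s1 t s3)).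
  + move=> t t'; rewrite !inE => ht ht' E.
    have [_ c2t _] := chain_card ht.
    have : t \in chain s1 t' s3 by rewrite -E !inE eqxx orbT.
    by move/(chain_mem ht') => [_ /(_ c2t)].
  + have <- : #|[set [set a; b]; [set a; c]]| = 2%N.
      rewrite cards2; case: eqVneq => // /setP/(_ b).
      by rewrite !inE eqxx orbT eq_sym (negPf ab) (negPf bc).
    apply: eq_card => t; rewrite !inE; apply/idP/idP => [ht|]; last first.
      case/orP => /eqP ->; rewrite s1E s3E; first by rewrite is_chain_abc -?s3E.
      by rewrite finset.setUAC is_chain_abc // finset.setUAC -s3E.
    have [a' [b' [c' [[ab' ac' bc'] s1E' -> s3E' _]]]] := chainP ht.
    have aa' : a' = a by apply: finset.set1_inj; rewrite -s1E'.
    have : b' \in s3 by rewrite s3E' !inE eqxx orbT.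
    rewrite aa' s3E !inE in ab' *; rewrite eq_sym (negPf ab') /=.
    by case/orP => /eqP ->; rewrite eqxx ?orbT.
  + move=> F; apply/andP/imsetP => [[/barycentricP[x1 [x2 [x3 [hx ->]]]]]|[t]].
      rewrite finset.subUset !finset.sub1set => /andP[/(chain_mem hx)[/(_ c1) e1 _ _]].
      by move=> /(chain_mem hx)[_ _ /(_ c3) e3]; exists x2; rewrite e1 e3 // inE.
    rewrite inE => ht ->; split; first exact: chain_barycentric.
    by rewrite finset.subUset !finset.sub1set !inE !eqxx !orbT.
- apply: (@card_barycentric_cofaces _ [set t | is_chain K t s2 s3] (fun t => chain t s2 s3)).
  + move=> t t'; rewrite !inE => ht ht' E.
    have [c1t _ _] := chain_card ht.
    have : t \in chain t' s2 s3 by rewrite -E !inE eqxx.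
    by move/(chain_mem ht') => [/(_ c1t)].
  + have <- : #|[set [set a]; [set b]]| = 2%N.
      by rewrite cards2; case: eqVneq => // /finset.set1_inj E; rewrite E eqxx in ab.
    apply: eq_card => t; rewrite !inE; apply/idP/idP => [ht|]; last first.
      case/orP => /eqP ->; rewrite s2E s3E; first by rewrite is_chain_abc -?s3E.
      by rewrite (finset.setUC [set a] [set b]) is_chain_abc 1?eq_sym //
        (finset.setUC [set b] [set a]) -s3E.
    have [a' [b' [c' [_ -> s2E' _ _]]]] := chainP ht.
    have : a' \in s2 by rewrite s2E' !inE eqxx.
    by rewrite s2E !inE => /orP[] /eqP ->; rewrite eqxx ?orbT.
  + move=> F; apply/andP/imsetP => [[/barycentricP[x1 [x2 [x3 [hx ->]]]]]|[t]].
      rewrite finset.subUset !finset.sub1set => /andP[/(chain_mem hx)[_ /(_ c2) e2 _]].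
      by move=> /(chain_mem hx)[_ _ /(_ c3) e3]; exists x1; rewrite e2 e3 // inE.
    rewrite inE => ht ->; split; first exact: chain_barycentric.
    by rewrite finset.subUset !finset.sub1set !inE !eqxx !orbT.
Qed.

Lemma sum_chain_edges (f : {set {set T}} -> 'F_2) s1 s2 s3 : is_chain K s1 s2 s3 ->
  \sum_(s in complex_edges (barycentric K) | s \subset chain s1 s2 s3) f s =
  f [set s1; s2] + f [set s1; s3] + f [set s2; s3].
Proof.
move=> h; have [n12 n13 n23] := chain_neq h.
by apply: sum_triangle_edges => //; exact: chain_barycentric.
Qed.

(* A cocycle f of the subdivision is pulled back to the sum of f over the two
   halves of each edge; if that is a coboundary, then so is f. *)
Lemma barycentric_H1 g : H1_le K g -> H1_le (barycentric K) g.
Proof.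
move=> [Phi PhiP].
pose edge_val (f : cochain {set T}) (v : T) (s : {set T}) : 'F_2 := f [set [set v]; s].
have [p pE] : exists p : 'Hom(cochain {set T}, cochain T),
    p =1 (fun f => [ffun s : {set T} => \sum_(v in s) edge_val f v s]).
  apply: linear_hom => a u v; apply/ffunP => s; rewrite !ffunE.
  rewrite [RHS](_ : _ = a * (\sum_(v in s) edge_val u v s) +
    \sum_(w in s) edge_val v w s) // mulr_sumr -big_split.
  by apply: eq_bigr => w _; rewrite /edge_val !ffunE.
exists (Phi \o p)%VF => f fcoc; rewrite lfunE /= => Phif0.
have f_tri v s t : is_chain K [set v] s t ->
    f [set [set v]; s] = f [set [set v]; t] + f [set s; t].
  move=> h; have := fcoc _ (chain_barycentric h); rewrite sum_chain_edges //.
  by move/eqP; rewrite -addrA addr_eq0 oppF2 => /eqP.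
(* Inside a triangle [t], both halves of the edge [s] can be replaced by segments to the center of
   [t]: the correction [f [set s; t]] occurs twice and cancels. *)
have p_edge (s t : {set T}) : #|s| = 2%N -> t \in K -> s \subset t ->
    p f s = \sum_(v in s) f [set [set v]; t].
  move=> s2 tK st; rewrite pE ffunE.
  under eq_bigr => v vs do rewrite /edge_val (f_tri v s t) ?/is_chain
    ?cards1 ?s2 ?tK ?finset.sub1set ?vs ?st //.
  rewrite big_split /= sumr_const s2 mulr2n addF2 addr0.
  by [].
have [||h hE] := PhiP (p f) => //.
  move=> t tK; rewrite -[RHS](coboundary_cocycle (fun v => f [set [set v]; t]) tK).
    apply: eq_bigr => s /andP[sK st]; rewrite (p_edge s t) //.
    by move: sK; rewrite inE => /andP[/eqP].
  exact: K_closed.1.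
(* So [h u + f [set [set u]; t]] is the same for all vertices [u] of [t]; this common value is the
   potential at the barycenter of [t]. *)
have const (t : {set T}) u v : t \in K -> u \in t -> v \in t ->
    h u + f [set [set u]; t] = h v + f [set [set v]; t].
  move=> tK ut vt; have [->//|uv] := eqVneq u v.
  have sK : [set u; v] \in complex_edges K by apply/complex_edgesP; exists u, v, t.
  have := hE _ sK; rewrite (p_edge _ t) ?cards2 ?uv ?finset.subUset ?finset.sub1set ?ut //.
  rewrite !big_setU1 ?inE //= !big_set1 => /eqP.
  rewrite -[X in _ == X]oppF2 -addr_eq0 => /eqP E; apply/eqP.
  by rewrite -[X in _ == X]oppF2 -addr_eq0 -[X in _ == X]E; apply/eqP; ring.
have const2 (s : {set T}) u v : s \in complex_edges K -> u \in s -> v \in s ->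
    h u + f [set [set u]; s] = h v + f [set [set v]; s].
  move=> sK us vs; have [->//|uv] := eqVneq u v.
  have sE : s = [set u; v].
    apply/esym/eqP; rewrite eqEcard finset.subUset !finset.sub1set us vs cards2 uv.
    by move: sK; rewrite inE => /andP[/eqP ->].
  have := hE _ sK; rewrite pE ffunE /edge_val {1 3}sE.
  rewrite !big_setU1 ?inE //= !big_set1 => /eqP.
  rewrite -[X in _ == X]oppF2 -addr_eq0 => /eqP E; apply/eqP.
  by rewrite -[X in _ == X]oppF2 -addr_eq0 -[X in _ == X]E; apply/eqP; ring.
(* On edges and triangles of [K] the value does not depend on the picked [v], by [const2] and
   [const]; the default 0 arises only for the empty set. *)
pose h' (s : {set T}) : 'F_2 := if #|s| == 1%N then \sum_(v in s) h v else
  if [pick v in s] is Some v then h v + f [set [set v]; s] else 0.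
have h'1 v : h' [set v] = h v by rewrite /h' cards1 eqxx big_set1.
have h'2 (s : {set T}) v : s \in complex_edges K -> v \in s -> h' s = h v + f [set [set v]; s].
  move=> sK vs; have s2 : #|s| = 2%N by move: sK; rewrite inE => /andP[/eqP].
  rewrite /h' s2 /=; case: pickP => [u us|/(_ v)]; first exact: const2.
  by rewrite vs.
have h'3 (t : {set T}) v : t \in K -> v \in t -> h' t = h v + f [set [set v]; t].
  move=> tK vt; rewrite /h' (K_closed.1 t tK) /=.
  case: pickP => [u ut|/(_ v)]; first exact: const.
  by rewrite vt.
exists h' => s /barycentric_edge[s1 [s2 [s3 [hc sE]]]].
have [n12 n13 n23] := chain_neq hc.
have [a [b [c [[ab ac bc] s1E s2E s3E s3K]]]] := chainP hc.
have sK : s2 \in complex_edges K.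
  by apply/complex_edgesP; exists a, b, s3; rewrite s2E s3E !inE !eqxx orbT -s3E.
have as2 : a \in s2 by rewrite s2E !inE eqxx.
have as3 : a \in s3 by rewrite s3E !inE eqxx.
have tri : f [set s1; s2] = f [set s1; s3] + f [set s2; s3].
  by rewrite s1E; apply: f_tri; rewrite -s1E.
case: sE => ->; rewrite big_setU1 ?inE //= big_set1.
- by rewrite s1E h'1 (h'2 _ a) // addrA addF2 add0r.
- by rewrite s1E h'1 (h'3 _ a) // addrA addF2 add0r.
rewrite (h'2 _ a) // (h'3 _ a) // -s1E tri addrACA addF2 add0r.
by rewrite addrAC addF2 add0r.
Qed.

End Barycentric.

(** * Barycentric coordinates under subdivision *)

Definition weights (R : realType) (T : finType) (K : {set {set T}}) (l : T -> R) :=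
  [/\ forall v, 0 <= l v, \sum_v l v = 1 &
    exists2 t, t \in K & forall v, l v != 0 -> v \in t].

Definition comb (R : realType) (T : finType) (n : nat) (pos : T -> 'rV[R]_n)
    (l : T -> R) : 'rV[R]_n := \sum_v l v *: pos v.

Definition barycenter (R : realType) (T : finType) (n : nat) (pos : T -> 'rV[R]_n)
    (s : {set T}) : 'rV[R]_n := #|s|%:R^-1 *: \sum_(v in s) pos v.

(** Coordinates with respect to the original vertices of the point whose coordinates in the
    subdivision are [m]: a barycenter shares its weight equally among its vertices. *)
Definition spread (R : realType) (T : finType) (m : {set T} -> R) (v : T) : R :=
  \sum_(s : {set T} | v \in s) m s / #|s|%:R.

Section BarycentricWeights.

Variables (R : realType) (T : finType) (K : {set {set T}}).
Hypothesis K_closed : closed_complex K.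

Lemma comb_barycenter n (pos : T -> 'rV[R]_n) (m : {set T} -> R) :
  comb (barycenter pos) m = comb pos (spread m).
Proof.
rewrite /comb /barycenter /spread.
under eq_bigr do rewrite scalerA scaler_sumr.
under [RHS]eq_bigr do rewrite scaler_suml.
by rewrite (exchange_big_dep predT).
Qed.

Lemma spread_chain (m : {set T} -> R) a b c : a != b -> a != c -> b != c ->
  (forall s, m s != 0 -> s \in chain [set a] [set a; b] [set a; b; c]) ->
  [/\ spread m a = m [set a] + m [set a; b] / 2 + m [set a; b; c] / 3,
      spread m b = m [set a; b] / 2 + m [set a; b; c] / 3,
      spread m c = m [set a; b; c] / 3 &
      forall v, v \notin [set a; b; c] -> spread m v = 0].
Proof.
move=> ab ac bc m0.
have c3 : #|[set a; b; c]| = 3%N.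
  rewrite -finset.setUA cardsU1 cards2 bc !inE negb_or ab ac //.
have n1 : [set a] \notin [set [set a; b]; [set a; b; c]].
  rewrite !inE negb_or; apply/andP; split; apply/eqP => E.
    by have := cards2 a b; rewrite -E cards1 ab.
  by move: c3; rewrite -E cards1.
have n2 : [set a; b] \notin [set [set a; b; c]].
  by rewrite !inE; apply/eqP => E; move: c3; rewrite -E cards2 ab.
have sE v : spread m v = (v \in [set a])%:R * m [set a] +
    (v \in [set a; b])%:R * (m [set a; b] / 2) +
    (v \in [set a; b; c])%:R * (m [set a; b; c] / 3).
  rewrite /spread big_mkcond /=.
  rewrite [LHS](bigID (mem (chain [set a] [set a; b] [set a; b; c]))) /=.
  rewrite [X in _ + X]big1 ?addr0.
    rewrite /chain -finset.setUA big_setU1 //= big_setU1 //= big_set1.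
    rewrite cards1 cards2 ab c3 addrA invr1 mulr1.
    by do 3 case: ifP => _; rewrite ?mul1r ?mul0r.
  move=> s sN; have /eqP -> : m s == 0 by apply: contraNT sN; exact: m0.
  by rewrite mul0r if_same.
split.
- by rewrite sE !inE !eqxx /= !mul1r.
- by rewrite sE !inE eqxx [b == a]eq_sym (negPf ab) /= mul0r add0r !mul1r.
- by rewrite sE !inE eqxx ![c == _]eq_sym (negPf ac) (negPf bc) /= !mul0r mul1r !add0r.
move=> v vN; rewrite sE (negPf vN); move: vN; rewrite !inE !negb_or.
by move=> /andP[/andP[/negPf -> /negPf ->] _]; rewrite !mul0r !addr0.
Qed.

Lemma weights_chain (m : {set T} -> R) : weights (barycentric K) m ->
  exists a b c, [/\ [/\ a != b, a != c & b != c], [set a; b; c] \in K &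
    forall s, m s != 0 -> s \in chain [set a] [set a; b] [set a; b; c]].
Proof.
move=> [m_ge0 m1 [_ /barycentricP[s1 [s2 [s3 [h ->]]]] ms]].
have [a [b [c [abc s1E s2E s3E s3K]]]] := chainP K_closed h.
by exists a, b, c; split=> //; [rewrite -s3E|move=> s /ms; rewrite s1E s2E s3E].
Qed.

Lemma spread_sum (m : {set T} -> R) a b c :
  (forall s, m s != 0 -> s \in chain [set a] [set a; b] [set a; b; c]) ->
  \sum_v spread m v = \sum_s m s.
Proof.
move=> ms; rewrite (exchange_big_dep predT) //=; apply: eq_bigr => s _.
have [s0|sn0] := eqVneq #|s| 0%N.
  have -> : m s = 0; last by rewrite big1 // => v _; rewrite mul0r.
  apply/eqP; apply: contra_eqT s0 => /ms; rewrite !inE.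
  by case/orP => [/orP[]|] /eqP ->; rewrite -lt0n; apply/card_gt0P; exists a;
    rewrite !inE eqxx.
by rewrite sumr_const -[_ *+ _]mulr_natr divfK // pnatr_eq0.
Qed.

Lemma spread_weights (m : {set T} -> R) :
  weights (barycentric K) m -> weights K (spread m).
Proof.
move=> mW; have [m_ge0 m1 _] := mW.
have [a [b [c [[ab ac bc] tK ms]]]] := weights_chain mW.
split.
- by move=> v; apply: sumr_ge0 => s _; rewrite divr_ge0.
- by rewrite (spread_sum ms).
- exists [set a; b; c] => // v; have [_ _ _ s0] := spread_chain ab ac bc ms.
  by apply: contraNT => /s0 ->.
Qed.

(* The weights of a barycentric combination are recovered from the coordinates:
   m s / #|s| is the gap between the smallest coordinate in s and the largest
   one outside s. *)
Definition gap (l : T -> R) (s : {set T}) (r : R) := forall u, u \in s ->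
  r / #|s|%:R <= l u /\ forall v, v \notin s -> r / #|s|%:R <= l u - l v.

Lemma chain_comparable (a b c : T) s s' :
  s \in chain [set a] [set a; b] [set a; b; c] ->
  s' \in chain [set a] [set a; b] [set a; b; c] -> s \subset s' \/ s' \subset s.
Proof.
have s1 : [set a] \subset [set a; b] by exact: finset.subsetUl.
have s2 : [set a; b] \subset [set a; b; c] by exact: finset.subsetUl.
have s3 := fintype.subset_trans s1 s2.
by rewrite !inE => /orP[/orP[]|] /eqP -> /orP[/orP[]|] /eqP ->; auto.
Qed.

(** The support of [p] is nested, so a set of the support that contains some [v] outside [s]
    contains all of [s]. Its contribution to [v] is matched by one to [u], and the share of [s]
    itself is left over. *)
Lemma gap_spread (p : {set T} -> R) s :
  weights (barycentric K) p -> p s != 0 -> gap (spread p) s (p s).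
Proof.
move=> pW ps0 u us; have [p_ge0 _ _] := pW.
have pd_ge0 s' : 0 <= p s' / #|s'|%:R by rewrite divr_ge0.
split=> [|v vs]; first by rewrite /spread (bigD1 s) //= lerDl sumr_ge0.
have [a [b [c [_ _ supp]]]] := weights_chain pW.
rewrite lerBrDr /spread [in leRHS](bigD1 s) //= lerD2l.
rewrite big_mkcond [leRHS]big_mkcond; apply: ler_sum => s' _ /=.
have [-> | ps'0] := eqVneq (p s') 0; first by rewrite mul0r !if_same.
case: ifP => vs'; last by case: ifP.
have [ss'|s's] := chain_comparable (supp _ ps0) (supp _ ps'0); last first.
  by rewrite (fintype.subsetP s's _ vs') in vs.
rewrite (fintype.subsetP ss' _ us) /=.
by case: eqVneq => // E; rewrite -E vs' in vs.
Qed.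

(** The coordinates of [spread p] weakly decrease along [a], [b], [c] and vanish elsewhere, so a set
    with a positive gap is an initial piece of this order; the gap of such a piece is the share of
    its own weight. *)
Lemma gap_le (p : {set T} -> R) (s : {set T}) (r : R) (u0 : T) : weights (barycentric K) p -> 0 < r ->
  u0 \in s -> gap (spread p) s r -> r <= p s.
Proof.
move=> pW r0 us sQ; have [p_ge0 _ _] := pW.
have [a [b [c [[ab ac bc] _ supp]]]] := weights_chain pW.
have [la lb lc l0] := spread_chain ab ac bc supp.
have p1 := p_ge0 [set a]; have p2 := p_ge0 [set a; b]; have p3 := p_ge0 [set a; b; c].
have rs : 0 < r / #|s|%:R by rewrite divr_gt0 // ltr0n; apply/card_gt0P; exists u0.
have sub u : u \in s -> [|| u == a, u == b | u == c].
  move=> /sQ[ru _]; have := lt_le_trans rs ru; apply: contraTT.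
  by move=> uN; rewrite l0 ?ltxx // !inE -orbA.
have as_ : a \in s.
  apply: contraT => /[dup] aN /(sQ u0 us).2 ra; have := lt_le_trans rs ra.
  have := sub _ us; case/or3P => /eqP uE; move: aN us; rewrite -?uE => aN us.
  - by rewrite us in aN.
  - rewrite uE; lra.
  - rewrite uE; lra.
have [bs|bN] := boolP (b \in s); have [cs|cN] := boolP (c \in s).
- have sE : s = [set a; b; c].
    apply/setP => u; rewrite !inE -orbA; apply/idP/idP => [/sub //|].
    by case/or3P => /eqP ->.
  have sc : #|s| = 3%N by rewrite sE -finset.setUA cardsU1 cards2 bc !inE negb_or ab ac.
  by have := (sQ c cs).1; rewrite sc sE lc; lra.
- have sE : s = [set a; b].
    apply/setP => u; rewrite !inE; apply/idP/idP => [us'|].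
      by case/or3P: (sub u us') (us') => /eqP -> //; rewrite ?eqxx ?orbT // (negPf cN).
    by case/orP => /eqP ->.
  have sc : #|s| = 2%N by rewrite sE cards2 ab.
  by have := (sQ b bs).2 c cN; rewrite sc sE lb lc; lra.
- by have := lt_le_trans rs ((sQ c cs).2 b bN); rewrite lb lc; lra.
- have sE : s = [set a].
    apply/setP => u; rewrite !inE; apply/idP/eqP => [us'|-> //].
    by case/or3P: (sub u us') (us') => /eqP -> //; rewrite ?(negPf cN) ?(negPf bN).
  have sc : #|s| = 1%N by rewrite sE cards1.
  by have := (sQ a as_).2 b bN; rewrite sc sE la lb; lra.
Qed.

Lemma spread_inj (m m' : {set T} -> R) : weights (barycentric K) m ->
  weights (barycentric K) m' -> spread m =1 spread m' -> m =1 m'.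
Proof.
have le (p q : {set T} -> R) s : weights (barycentric K) p ->
    weights (barycentric K) q -> spread p =1 spread q -> p s <= q s.
  move=> pW qW pq; have [p_ge0 _ _] := pW; have [q_ge0 _ _] := qW.
  have [->//|ps0] := eqVneq (p s) 0.
  have [a [b [c [_ _ supp]]]] := weights_chain pW.
  have as_ : a \in s.
    by have := supp _ ps0; rewrite !inE => /orP[/orP[]|] /eqP ->; rewrite !inE eqxx.
  apply: (gap_le qW _ as_); first by rewrite lt_def ps0 p_ge0.
  move=> u /(gap_spread pW ps0)[ru rv]; rewrite -pq; split=> // v /rv.
  by rewrite -pq.
by move=> mW m'W mm' s; apply/le_anti; rewrite !le // => u; rewrite mm'.
Qed.

Lemma spread_surj (l : T -> R) : weights K l ->
  exists m, weights (barycentric K) m /\ spread m =1 l.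
Proof.
move=> [l_ge0 l1 [t tK lt]].
have [a [b [c [ab ac bc tE [lab lbc]]]]] : exists a b c,
    [/\ a != b, a != c, b != c, t = [set a; b; c] & l b <= l a /\ l c <= l b].
  have [a [b [c [ab ac bc ->]]]] := set3P (K_closed.1 t tK).
  have E x y z : x \in [set a; b; c] -> y \in [set a; b; c] -> z \in [set a; b; c] ->
      x != y -> x != z -> y != z -> [set a; b; c] = [set x; y; z].
    move=> xt yt zt xy xz yz; apply/esym/eqP.
    rewrite eqEcard !finset.subUset !finset.sub1set xt yt zt /=.
    by rewrite -!finset.setUA !cardsU1 !cards1 !inE !negb_or ab ac bc xy xz yz.
  have [at_ bt ct] : [/\ a \in [set a; b; c], b \in [set a; b; c] & c \in [set a; b; c]].
    by rewrite !inE !eqxx !orbT.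
  have [ba ca cb] : [/\ b != a, c != a & c != b] by split; rewrite eq_sym.
  have [lab|/ltW lab] := leP (l b) (l a); have [lbc|/ltW lbc] := leP (l c) (l b);
    have [lac|/ltW lac] := leP (l c) (l a).
  - by exists a, b, c.
  - by exists a, b, c.
  - by exists a, c, b; split=> //; apply: E.
  - by exists c, a, b; split=> //; apply: E.
  - by exists b, a, c; split=> //; apply: E.
  - by exists b, c, a; split=> //; apply: E.
  - by exists c, b, a; split=> //; apply: E.
  - by exists c, b, a; split=> //; apply: E.
have tK' : [set a; b; c] \in K by rewrite -tE.
have h := is_chain_abc ab tK'; have [n12 n13 n23] := chain_neq K_closed h.
(* With the coordinates sorted, each member of the flag gets the drop to the next coordinate times
   its number of vertices. *)
pose m (s : {set T}) : R := if s == [set a] then l a - l b else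
  if s == [set a; b] then 2 * (l b - l c) else
  if s == [set a; b; c] then 3 * l c else 0.
have ma : m [set a] = l a - l b by rewrite /m eqxx.
have mb : m [set a; b] = 2 * (l b - l c) by rewrite /m [_ == [set a]]eq_sym (negPf n12) eqxx.
have mc : m [set a; b; c] = 3 * l c.
  by rewrite /m [_ == [set a]]eq_sym (negPf n13) [_ == [set a; b]]eq_sym (negPf n23) eqxx.
have supp s : m s != 0 -> s \in chain [set a] [set a; b] [set a; b; c].
  rewrite /m !inE; case: (s == [set a]) => //; case: (s == [set a; b]) => //.
  by case: (s == [set a; b; c]) => //; rewrite eqxx.
have [sa sb sc s0] := spread_chain ab ac bc supp.
have sE : spread m =1 l.
  move=> v; have [|vN] := boolP (v \in [set a; b; c]); last first.
    by rewrite s0 //; apply/esym/eqP; apply: contraNT vN => /lt; rewrite tE.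
  rewrite !inE => /orP[/orP[]|] /eqP ->; rewrite ?sa ?sb ?sc ?ma ?mb mc; lra.
exists m; split=> //; split.
- move=> s; rewrite /m; have := l_ge0 c.
  by case: ifP => _; [|case: ifP => _; [|case: ifP => _]]; lra.
- by rewrite -(spread_sum supp) -l1; apply: eq_bigr => v _; rewrite sE.
- exists (chain [set a] [set a; b] [set a; b; c]) => //.
  exact: chain_barycentric.
Qed.

Definition mesh_le (T' : finType) (K' : {set {set T'}}) n (pos : T' -> 'rV[R]_n) d :=
  forall t, t \in K' -> forall u v, u \in t -> v \in t ->
    forall i, `|pos u ord0 i - pos v ord0 i| <= d.

(** The worst case is a vertex against the center of its triangle, the mean of three differences one
    of which is zero; this gives 2/3. *)
Lemma barycentric_mesh n (pos : T -> 'rV[R]_n) d : mesh_le K pos d ->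
  mesh_le (barycentric K) (barycenter pos) (2 / 3 * d).
Proof.
move=> posd _ /barycentricP[s1 [s2 [s3 [h ->]]]] u v ut vt i.
have [a [b [c [[ab ac bc] s1E s2E s3E s3K]]]] := chainP K_closed h.
have [c1 c2 c3] := chain_card K_closed h.
have [as_ bs cs] : [/\ a \in s3, b \in s3 & c \in s3] by rewrite s3E !inE !eqxx !orbT.
have := posd _ s3K a b as_ bs i; have := posd _ s3K a c as_ cs i.
have := posd _ s3K b c bs cs i.
have e1 : barycenter pos s1 ord0 i = pos a ord0 i.
  by rewrite /barycenter c1 s1E big_set1 mxE invr1 mul1r.
have e2 : barycenter pos s2 ord0 i = (pos a ord0 i + pos b ord0 i) / 2.
  by rewrite /barycenter c2 s2E big_setU1 ?inE //= big_set1 !mxE mulrC.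
have e3 : barycenter pos s3 ord0 i = (pos a ord0 i + pos b ord0 i + pos c ord0 i) / 3.
  rewrite /barycenter c3 s3E -finset.setUA big_setU1 ?inE ?negb_or ?ab //=.
  by rewrite big_setU1 ?inE //= big_set1 !mxE addrA mulrC.
rewrite !ler_norml => /andP[? ?] /andP[? ?] /andP[? ?].
move: ut vt; rewrite !inE => /orP[/orP[]|] /eqP -> /orP[/orP[]|] /eqP ->;
  rewrite ?e1 ?e2 ?e3; apply/andP; split; lra.
Qed.

End BarycentricWeights.

(** * Cohomology of a triangulated surface *)

Definition complex_vertices (T : finType) (K : {set {set T}}) : {set T} :=
  [set v | [exists t in K, v \in t]].

(** Coordinates in a basis of [U], padded with zeros up to length [g]. *)
Lemma hom_of_dim (F : fieldType) (vT : vectType F) (U : {vspace vT}) g :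
  (\dim U <= g)%N ->
  exists Phi : 'Hom(vT, 'rV[F]_g), forall u, u \in U -> Phi u = 0 -> u = 0.
Proof.
move=> Ug; have [Phi PhiE] : exists Phi : 'Hom(vT, 'rV[F]_g), Phi =1
    (fun u => \row_j if insub (val j) is Some i then coord (vbasis U) i u else 0).
  apply: linear_hom => a u v; apply/rowP => j; rewrite !mxE.
  by case: insubP => [i _ _|_]; rewrite ?linearP // mulr0 addr0.
exists Phi => u uU; rewrite PhiE => /rowP u0; rewrite (coord_vbasis uU) big1 // => i _.
have := u0 (widen_ord Ug i); rewrite !mxE; case: insubP => [j _ ji|]; last first.
  by rewrite /= ltn_ord.
have -> : j = i by apply: val_inj.
by move=> ->; rewrite scale0r.
Qed.

Section Euler.

Variables (T : finType) (K : {set {set T}}) (g : nat).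
Hypothesis K_closed : closed_complex K.
(** Connectedness is used in linear form: this hypothesis bounds the zeroth cohomology, the next one
    the cycles of dimension two, by one dimension each. *)
Hypothesis skeleton_connected : forall h : T -> 'F_2,
  (forall s, s \in complex_edges K -> \sum_(v in s) h v = 0) ->
  {in complex_vertices K &, forall u v, h u = h v}.
Hypothesis strongly_connected : forall x : {set T} -> 'F_2,
  (forall s, s \in complex_edges K -> \sum_(t in K | s \subset t) x t = 0) ->
  {in K &, forall t t', x t = x t'}.
Hypothesis euler : (#|complex_edges K| + 2 <= #|complex_vertices K| + #|K| + g)%N.

Let E := {s : {set T} | s \in complex_edges K}.
Let F := {t : {set T} | t \in K}.
Let N := {v : T | v \in complex_vertices K}.

Lemma dim_constants (I : finType) (W : {vspace {ffun I -> ('F_2)^o}}) :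
  (forall w, w \in W -> forall i j, w i = w j) -> (\dim W <= 1)%N.
Proof.
move=> Wconst; have : (W <= <[([ffun=> 1] : {ffun I -> ('F_2)^o})]>)%VS.
  apply/subvP => w /Wconst wE; apply/vlineP.
  have [i _|I0] := pickP I; last by exists 0; apply/ffunP => i; have := I0 i.
  by exists (w i); apply/ffunP => j; rewrite !ffunE (wE j i) /GRing.scale /= mulr1.
by move=> /dimvS /leq_trans; apply; rewrite dim_vline leq_b1.
Qed.

(** The ranks of [d0] and [d1] are at least [#|complex_vertices K| - 1] and [#|K| - 1], so the
    kernel of [d1] modulo the image of [d0] has dimension at most edges - vertices - triangles + 2,
    which is at most [g]. *)
Lemma euler_H1 : H1_le K g.
Proof.
have [d0 d0E] : exists d0 : 'Hom({ffun N -> ('F_2)^o}, {ffun E -> ('F_2)^o}),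
    d0 =1 (fun h => [ffun s : E => \sum_(v : N | val v \in val s) h v]).
  apply: linear_hom => a u v; apply/ffunP => s; rewrite !ffunE.
  rewrite [RHS](_ : _ = a * (\sum_(w : N | val w \in val s) u w) +
    \sum_(w : N | val w \in val s) v w) // mulr_sumr -big_split.
  by apply: eq_bigr => w _; rewrite !ffunE.
have [d1 d1E] : exists d1 : 'Hom({ffun E -> ('F_2)^o}, {ffun F -> ('F_2)^o}),
    d1 =1 (fun f => [ffun t : F => \sum_(s : E | val s \subset val t) f s]).
  apply: linear_hom => a u v; apply/ffunP => s; rewrite !ffunE.
  rewrite [RHS](_ : _ = a * (\sum_(w : E | val w \subset val s) u w) +
    \sum_(w : E | val w \subset val s) v w) // mulr_sumr -big_split.
  by apply: eq_bigr => w _; rewrite !ffunE.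
have edge_vertices s v : s \in complex_edges K -> v \in s -> v \in complex_vertices K.
  rewrite !inE => /andP[_ /existsP[t /andP[tK st]]] vs.
  by apply/existsP; exists t; rewrite tK (fintype.subsetP st).
have sum_edge (h : T -> 'F_2) s : s \in complex_edges K ->
    \sum_(v : N | val v \in s) h (val v) = \sum_(v in s) h v.
  move=> sK; rewrite -(big_sub_cond (mem (complex_vertices K)) (mem s)) /=.
  by apply: eq_bigl => v; rewrite andb_idl //; exact: edge_vertices.
have sum_tri (f : {set T} -> 'F_2) (t : {set T}) :
    \sum_(s : E | val s \subset t) f (val s) =
    \sum_(s in complex_edges K | s \subset t) f s.
  by rewrite -(big_sub_cond (mem (complex_edges K)) (fun s => s \subset t)).
have dimE : \dim {:{ffun E -> ('F_2)^o}} = #|complex_edges K|.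
  by rewrite dim_ffun card_sig; apply: eq_card => s; rewrite inE.
have rank0 : (#|complex_vertices K| <= \dim (limg d0) + 1)%N.
  have -> : #|complex_vertices K| = #|{: N}|.
    by rewrite card_sig; apply: eq_card => s; rewrite inE.
  rewrite -(dim_ffun 'F_2) -(limg_ker_dim d0) capfv addnC leq_add2l.
  apply: dim_constants => h; rewrite memv_ker d0E => /eqP/ffunP h0 u v.
  pose h' w := if insub w is Some w' then h w' else 0.
  have h'E w : h' (val w) = h w by rewrite /h' valK.
  rewrite -!h'E; apply: skeleton_connected; rewrite ?(valP u) ?(valP v) // => s sK.
  rewrite -sum_edge //; have := h0 (exist _ s sK); rewrite !ffunE /= => h0s.
  by rewrite -[RHS]h0s; apply: eq_bigr => w _; rewrite h'E.
(* What is orthogonal to the image of [d1] is a cycle of triangles, hence constant. *)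
have rank1 : (#|K| <= \dim (limg d1) + 1)%N.
  have [W [dimW WE]] := orthogonal_space (limg d1).
  have -> : #|K| = #|{: F}| by rewrite card_sig; apply: eq_card => s; rewrite inE.
  apply: leq_trans dimW _; rewrite addnC leq_add2l.
  apply: dim_constants => x /WE x0 u v.
  pose x' w := if insub w is Some w' then x w' else 0.
  have x'E w : x' (val w) = x w by rewrite /x' valK.
  rewrite -!x'E; apply: strongly_connected; rewrite ?(valP u) ?(valP v) // => s sK.
  pose del : {ffun E -> ('F_2)^o} := [ffun s' : E => (val s' == s)%:R].
  rewrite (big_sub_cond (mem K) (fun t => s \subset t)) /=.
  have := x0 (d1 del); rewrite memv_img ?memvf // => /(_ isT); apply: etrans.
  rewrite big_mkcond /=; apply: eq_bigr => t _; rewrite d1E ffunE x'E.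
  rewrite big_mkcond (bigD1 (exist _ s sK)) //= ffunE eqxx.
  rewrite big1 ?addr0; last first.
    move=> s' /negPf s's; rewrite ffunE; case: eqP => [E'|_]; last by rewrite if_same.
    by move: s's; rewrite -val_eqE /= E' eqxx.
  by case: ifP; rewrite ?mulr1 ?mulr0.
(* [pi] kills exactly [B], so the image of the cocycles under [pi] stands for the quotient by
   coboundaries. *)
pose B := limg d0; pose pi := (\1 - projv B)%VF.
have piE f : pi f = f - projv B f by rewrite /pi add_lfunE id_lfunE opp_lfunE.
have Bcocycle : (B <= lker d1)%VS.
  apply/subvP => _ /memv_imgP[h _ ->]; rewrite memv_ker d0E d1E.
  apply/eqP/ffunP => t; rewrite !ffunE.
  pose h' w := if insub w is Some w' then h w' else 0.
  have h'E w : h' (val w) = h w by rewrite /h' valK.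
  rewrite -[RHS](coboundary_cocycle h' (valP t) (K_closed.1 _ (valP t))) -sum_tri.
  apply: eq_bigr => s _; rewrite ffunE -sum_edge ?(valP s) //.
  by apply: eq_bigr => v _; rewrite h'E.
have dimpi : (\dim (pi @: lker d1) <= g)%N.
  have k1 := limg_ker_dim d1 fullv; rewrite capfv dimE in k1.
  have k2 := limg_ker_dim pi (lker d1).
  have k3 : (\dim B <= \dim (lker d1 :&: lker pi))%N.
    apply: dimvS; rewrite subv_cap Bcocycle; apply/subvP => b bB.
    by rewrite memv_ker piE projv_id ?subrr.
  rewrite -/B in rank0; lia.
have [Phi PhiP] := hom_of_dim dimpi.
have [res resE] : exists res : 'Hom(cochain T, {ffun E -> ('F_2)^o}),
    res =1 (fun f => [ffun s : E => f (val s)]).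
  by apply: linear_hom => a u v; apply/ffunP => s; rewrite !ffunE.
exists (Phi \o pi \o res)%VF => f fcoc; rewrite !lfunE /= lfunE /= => Phi0.
have : res f \in B.
  suff /eqP : pi (res f) = 0 by rewrite piE subr_eq0 => /eqP ->; exact: memv_proj.
  apply: PhiP Phi0; apply: memv_img; rewrite memv_ker d1E.
  apply/eqP/ffunP => t; rewrite !ffunE -[RHS](fcoc _ (valP t)) -sum_tri.
  by apply: eq_bigr => s _; rewrite resE ffunE.
move=> /memv_imgP[h _ /ffunP fE].
pose h' w := if insub w is Some w' then h w' else 0.
have h'E w : h' (val w) = h w by rewrite /h' valK.
exists h' => s sK; have := fE (exist _ s sK); rewrite resE d0E !ffunE /= => ->.
by rewrite -sum_edge //; apply: eq_bigr => v _; rewrite h'E.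
Qed.

End Euler.

(** * Connected sets in geometric complexes and fine subdivisions *)

Lemma closed_cover_chain (X : topologicalType) (A : set X) (I : finType)
    (C : I -> set X) (P : pred I) : connected A ->
  (forall i, closed (C i)) -> (A `<=` \bigcup_i C i)%classic ->
  (forall i j x, A x -> C i x -> C j x -> P i = P j) ->
  forall i j x y, A x -> A y -> C i x -> C j y -> P i = P j.
Proof.
move=> cA cC cov same.
suff key (Q : pred I) : (forall i j x, A x -> C i x -> C j x -> Q i = Q j) ->
    forall i j x y, A x -> A y -> C i x -> C j y -> Q i -> Q j.
  move=> i j x y Ax Ay Ci Cj.
  have H1 := key P same _ _ _ _ Ax Ay Ci Cj.
  have H2 := key P same _ _ _ _ Ay Ax Cj Ci.
  by apply/idP/idP.
move=> {}same i j x y Ax Ay Ci Cj Qi.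
(* The unions over the two classes are closed, cover [A] and are disjoint in [A]; so [U true] is
   clopen in the connected [A] and exhausts it. *)
pose U (b : bool) := (\bigcup_(k in [set k | Q k = b]) C k)%classic.
have cU b : closed (U b).
  by apply: closed_bigcup => [|k _]; [exact: finite_finset|exact: cC].
have : (A `&` U true)%classic = A.
  apply: cA; first by exists x; split=> //; exists i.
  - exists (~` U false)%classic; first exact: closed_openC.
    apply/seteqP; split=> z [Az]; last first.
      have [k _ Ck] := cov _ Az => nU; split=> //; exists k => //=.
      by apply: contra_notT nU => /negPf Qk; exists k.
    move=> [k /= Qk Ck]; split=> // -[l /= Ql Cl].
    by move: (same k l z Az Ck Cl); rewrite Qk Ql.
  - by exists (U true).
move=> /seteqP[_ /(_ y Ay)[_ [k /= Qk Ck]]].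
by rewrite -(same k j y Ay Ck Cj).
Qed.

Definition hull (R : realType) (T : finType) (n : nat) (pos : T -> 'rV[R]_n)
    (t : {set T}) : set 'rV[R]_n :=
  [set x | exists l : T -> R, [/\ forall v, 0 <= l v, \sum_v l v = 1,
     forall v, l v != 0 -> v \in t & comb pos l = x]]%classic.

Lemma continuous_sum (R : realType) (X : topologicalType) (Y : normedModType R)
    (I : Type) (r : seq I) (F : I -> X -> Y) :
  (forall i, continuous (F i)) -> continuous (fun x => \sum_(i <- r) F i x).
Proof.
move=> cF; elim: r => [|i r IHr] x.
  by under eq_fun do rewrite big_nil; exact: cvg_cst.
under eq_fun do rewrite big_cons; apply: cvgD.
  exact: cF.
exact: IHr.
Qed.

(** The hull is the continuous image of a compact set: the weight vectors in the unit cube with sum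
    1 and no weight outside [t]. *)
Lemma hull_closed (R : realType) (T : finType) n (pos : T -> 'rV[R]_n) t :
  closed (hull pos t).
Proof.
pose S (P : pred 'I_#|T|) (l : 'rV[R]_#|T|) : R := \sum_(i <- enum P) l ord0 i.
have cS P : continuous (S P).
  by apply: continuous_sum => i; exact: coord_continuous.
pose out : pred 'I_#|T| := fun i => enum_val i \notin t.
pose D := [set l : 'rV[R]_#|T| | forall i, `[(0 : R), 1]%classic (l ord0 i)]%classic.
pose D' := (D `&` (S predT @^-1` [set x | x = 1%R] `&` S out @^-1` [set x | x = 0%R]))%classic.
have cS_eq P y : closed (S P @^-1` [set x | x = y])%classic.
  by apply: (continuous_closedP _).1 => //; exact: closed_eq.
have cD : compact D := rV_compact (fun=> @segment_compact R 0 1).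
have cD' : compact D'.
  apply: (@subclosed_compact _ _ D) => //; last by move=> l [].
  apply: closedI; first exact: (compact_closed (@norm_hausdorff _ _) cD).
  by apply: closedI.
pose f (l : 'rV[R]_#|T|) := \sum_(i <- enum 'I_#|T|) l ord0 i *: pos (enum_val i).
have cf : continuous f.
  apply: continuous_sum => i l.
  exact: cvgZr_tmp (@coord_continuous R _ _ ord0 i l).
suff -> : hull pos t = (f @` D')%classic.
  apply: (compact_closed (@norm_hausdorff _ _)).
  by apply: continuous_compact => //; exact: continuous_subspaceT.
have reix (M : nmodType) (G : T -> M) :
    \sum_(i <- enum 'I_#|T|) G (enum_val i) = \sum_v G v.
  by rewrite big_enum /= [RHS](reindex (@enum_val T T)) //; exact/onW_bij/enum_val_bij.
apply/seteqP; split=> x.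
  move=> [l [l0 l1 lt <-]]; exists (\row_i l (enum_val i)).
    split=> [i|]; rewrite /= ?mxE.
      rewrite in_itv /= l0 -l1 (bigD1 (enum_val i)) //= lerDl sumr_ge0 //.
    split; rewrite /S.
      rewrite -l1 -[RHS]reix; apply: eq_big_seq => i _; rewrite mxE //.
    rewrite big_seq big1 // => i; rewrite mem_enum mxE => iout.
    by apply/eqP; apply: contraNT iout => /lt.
  rewrite /f /comb -[RHS]reix; apply: eq_bigr => i _; by rewrite mxE.
move=> [l [lD [l1 l0]] <-].
have l_ge0 i : 0 <= l ord0 i by have := lD i; rewrite /= in_itv /= => /andP[].
exists (fun v => l ord0 (enum_rank v)); split=> //.
- by rewrite -l1 /S -[LHS]reix; apply: eq_bigr => i _; rewrite enum_valK.
- move=> v; apply: contraNT => vt; move: l0; rewrite /S /= big_enum /= => l0.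
  by apply/eqP/(psumr_eq0P (fun i _ => l_ge0 i) l0); rewrite unfold_in /out enum_rankK.
- by rewrite /f /comb -[LHS]reix; apply: eq_bigr => i _; rewrite enum_valK.
Qed.

Section GeometricComplex.

Variables (R : realType) (n : nat) (X : set 'rV[R]_n).
Variables (T : finType) (K : {set {set T}}) (pos : T -> 'rV[R]_n).
Hypothesis pos_cover : forall x, X x -> exists l, weights K l /\ comb pos l = x.
Hypothesis pos_inj : forall l l', weights K l -> weights K l' ->
  comb pos l = comb pos l' -> l =1 l'.

(** Weights are unique, so a common point has one weight function, supported in both triangles. *)
Lemma hull_meet t t' x : t \in K -> t' \in K -> hull pos t x -> hull pos t' x ->
  exists v, v \in t /\ v \in t'.
Proof.
move=> tK t'K [l [l0 l1 lt lx]] [l' [l'0 l'1 l't l'x]].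
have ll' : l =1 l'.
  by apply: pos_inj; [split=> //; exists t|split=> //; exists t'|rewrite lx].
have [v lv] : exists v, l v != 0.
  apply/existsP; apply: contraT; rewrite negb_exists => /forallP l_0.
  have : \sum_v l v = 0 by apply: big1 => v _; apply/eqP; have := l_0 v; rewrite negbK.
  by move/eqP; rewrite l1 oner_eq0.
by exists v; split; [exact: lt|apply: l't; rewrite -ll'].
Qed.

Lemma cover_hull x : X x -> exists2 t, t \in K & hull pos t x.
Proof.
by move=> /pos_cover[l [[l0 l1 [t tK lt]] lx]]; exists t => //; exists l.
Qed.

(** The triangles that meet [A] cover it by finitely many closed hulls, and two of them with a
    common point share a vertex. Hence what passes between triangles sharing a vertex spreads along
    the connected [A]. *)
Lemma complex_chain (A : set 'rV[R]_n) (P : pred {set T}) :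
  connected A -> (A `<=` X)%classic ->
  (forall t t' v x x', t \in K -> t' \in K -> v \in t -> v \in t' ->
     A x -> hull pos t x -> A x' -> hull pos t' x' -> P t -> P t') ->
  forall t t' x x', t \in K -> t' \in K -> A x -> hull pos t x ->
    A x' -> hull pos t' x' -> P t -> P t'.
Proof.
move=> cA AX Pstep t t' x x' tK t'K Ax tx Ax' t'x' Pt.
pose C t := [set y | t \in K /\ hull pos t y]%classic.
have same i j y : A y -> C i y -> C j y -> P i = P j.
  move=> Ay [iK iy] [jK jy]; have [v [vi vj]] := hull_meet iK jK iy jy.
  by apply/idP/idP; apply: Pstep; eassumption.
rewrite -(@closed_cover_chain _ A _ C P cA _ _ same t t' x x') //.
- move=> i; have [iK|iN] := boolP (i \in K).
    rewrite (_ : C i = hull pos i); first exact: hull_closed.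
    by apply/seteqP; split=> y; [case|].
  rewrite (_ : C i = set0); first exact: closed0.
  by apply/seteqP; split=> y // -[]; rewrite (negPf iN).
- by move=> y /AX /cover_hull[i iK iy]; exists i.
Qed.

End GeometricComplex.

(** These properties pass to the barycentric subdivision, with [X] and [g] fixed while the mesh [d]
    shrinks. *)
Definition geometric_complex (R : realType) n (X : set 'rV[R]_n) (g : nat) (d : R)
    (T : finType) (K : {set {set T}}) (pos : T -> 'rV[R]_n) :=
  [/\ closed_complex K, H1_le K g,
      forall x, X x -> exists l, weights K l /\ comb pos l = x,
      forall l l', weights K l -> weights K l' -> comb pos l = comb pos l' -> l =1 l' &
      mesh_le K pos d].

Lemma geometric_barycentric (R : realType) n (X : set 'rV[R]_n) g d (T : finType)
    (K : {set {set T}}) (pos : T -> 'rV[R]_n) :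
  geometric_complex X g d K pos ->
  geometric_complex X g (2 / 3 * d) (barycentric K) (barycenter pos).
Proof.
move=> [Kc KH cov inj mesh]; split.
- exact: barycentric_closed.
- exact: barycentric_H1.
- move=> x /cov[l [lW lx]]; have [m [mW ml]] := spread_surj Kc lW.
  exists m; split=> //; rewrite comb_barycenter -lx.
  by apply: eq_bigr => v _; rewrite ml.
- move=> l l' lW l'W; rewrite !comb_barycenter => E.
  apply: (spread_inj Kc) => //; apply: inj E; exact: spread_weights.
- exact: barycentric_mesh.
Qed.

Lemma geometric_fine (R : realType) n (X : set 'rV[R]_n) g d (T : finType)
    (K : {set {set T}}) (pos : T -> 'rV[R]_n) (eps : R) :
  geometric_complex X g d K pos -> 0 < eps ->
  exists (T' : finType) (K' : {set {set T'}}) (pos' : T' -> 'rV[R]_n),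
    geometric_complex X g eps K' pos'.
Proof.
move=> Kgeo eps0.
have [k kE] : exists k, (2 / 3) ^+ k * d <= eps.
  (* Bernoulli's inequality for the powers of 3/2, written for their inverses. *)
  have pow k : (2 / 3 : R) ^+ k * (1 + k%:R / 2) <= 1.
    elim: k => [|k IHk]; first by rewrite expr0 mul0r addr0 mul1r.
    have q0 : 0 <= (2 / 3 : R) ^+ k by apply: exprn_ge0; lra.
    have qk : 0 <= (2 / 3 : R) ^+ k * k%:R by rewrite mulr_ge0.
    rewrite exprS -[k.+1%:R]natr1; move: IHk q0 qk; move: (_ ^+ k) (k%:R) => q r.
    have -> : q * (1 + r / 2) = q + q * r / 2 by field.
    have -> : 2 / 3 * q * (1 + (r + 1) / 2) = q + q * r / 3 by field.
    by move: (q * r) => p; lra.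
  have [k kd] : exists k : nat, d <= eps * (1 + k%:R / 2).
    exists (Num.truncn (2 * d / eps)).+1.
    have := truncnS_gt (2 * d / eps); rewrite ltr_pdivrMr //.
    move: ((Num.truncn (2 * d / eps)).+1%:R : R) => r.
    have -> : eps * (1 + r / 2) = eps + r * eps / 2 by field.
    by move: (r * eps) => p; lra.
  exists k; have := pow k; have : 0 <= (2 / 3 : R) ^+ k by apply: exprn_ge0; lra.
  by nra.
suff [T' [K' [pos' [Kc KH cov inj mesh]]]] : exists (T' : finType) (K' : {set {set T'}})
    (pos' : T' -> 'rV[R]_n), geometric_complex X g ((2 / 3) ^+ k * d) K' pos'.
  exists T', K', pos'; split=> // t tK u v ut vt i.
  exact: le_trans (mesh t tK u v ut vt i) kE.
elim: k {kE} => [|k [T' [K' [pos' IHk]]]].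
  by exists T, K, pos; rewrite expr0 mul1r.
exists _, (barycentric K'), (barycenter pos'); rewrite exprS -mulrA; exact: geometric_barycentric IHk.
Qed.

(** * The given triangulation as a geometric complex *)

Definition vertex_pos (R : realType) (n : nat) (i : 'I_n) : 'rV[R]_n := delta_mx ord0 i.

Lemma comb_vertex_pos (R : realType) n (l : 'I_n -> R) i :
  comb (@vertex_pos R n) l ord0 i = l i.
Proof.
rewrite /comb summxE (bigD1 i) //= !mxE !eqxx mulr1 big1 ?addr0 // => j /negPf ji.
by rewrite !mxE eqxx eq_sym ji mulr0.
Qed.

Lemma realization_cover (R : realType) n (K : {set {set 'I_n}}) x :
  realization K x -> exists l : 'I_n -> R, weights K l /\ comb (@vertex_pos R n) l = x.
Proof.
move=> [x0 x1 [t tK xt]]; exists (fun i => x ord0 i); split.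
  by split=> //; exists t.
by apply/rowP => i; rewrite comb_vertex_pos.
Qed.

Lemma vertex_pos_inj (R : realType) n (K : {set {set 'I_n}}) (l l' : 'I_n -> R) :
  weights K l -> weights K l' ->
  comb (@vertex_pos R n) l = comb (@vertex_pos R n) l' -> l =1 l'.
Proof. by move=> _ _ E i; rewrite -(comb_vertex_pos l) E comb_vertex_pos. Qed.

Lemma realization_vertex (R : realType) n (K : {set {set 'I_n}}) t v : t \in K -> v \in t ->
  realization K (vertex_pos R v) /\ hull (@vertex_pos R n) t (vertex_pos R v).
Proof.
move=> tK vt.
have sum1 : \sum_i (i == v)%:R = 1 :> R.
  by rewrite (bigD1 v) //= eqxx big1 ?addr0 // => i /negPf ->.
have vE i : vertex_pos R v ord0 i = (i == v)%:R by rewrite mxE eqxx.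
split.
  split=> [i||]; first by rewrite vE.
    by rewrite -sum1; apply: eq_bigr => i _; rewrite vE.
  exists t => // i; rewrite vE pnatr_eq0 eqb0 negbK => /eqP -> //.
exists (fun i => (i == v)%:R); split=> //.
  by move=> i; rewrite pnatr_eq0 eqb0 negbK => /eqP ->.
by apply/rowP => i; rewrite comb_vertex_pos vE.
Qed.

Section SurfaceComplex.

Variables (R : realType) (n g : nat) (K : {set {set 'I_n}}).
Hypothesis K_surface : surface_complex K.
Hypothesis K_connected : connected (@realization R n K).
Hypothesis K_euler : g%:Z = 2 - euler_characteristic K.

Lemma surface_closed : closed_complex K.
Proof. by have [K3 K2 _] := K_surface; split. Qed.

Lemma surface_chain (P : pred {set 'I_n}) :
  (forall t t' v, t \in K -> t' \in K -> v \in t -> v \in t' -> P t -> P t') ->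
  forall t t', t \in K -> t' \in K -> P t -> P t'.
Proof.
move=> Pstep t t' tK t'K.
have [v vt] : exists v, v \in t by apply/card_gt0P; rewrite surface_closed.1.
have [v' vt'] : exists v, v \in t' by apply/card_gt0P; rewrite surface_closed.1.
have [Kv tv] := realization_vertex R tK vt.
have [Kv' tv'] := realization_vertex R t'K vt'.
apply: (complex_chain (@realization_cover R n K) (@vertex_pos_inj R n K) K_connected
  _ _ tK t'K Kv tv Kv' tv') => //.
by move=> t1 t2 w x x' t1K t2K wt1 wt2 _ _ _ _; exact: Pstep wt2.
Qed.

Lemma surface_skeleton (h : 'I_n -> 'F_2) :
  (forall s, s \in complex_edges K -> \sum_(v in s) h v = 0) ->
  {in complex_vertices K &, forall u v, h u = h v}.
Proof.
move=> h0 u v; rewrite !inE => /exists_inP[t tK ut] /exists_inP[t' t'K vt'].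
have hE s a b : s \in K -> a \in s -> b \in s -> h a = h b.
  move=> sK as_ bs; have [->//|ab] := eqVneq a b.
  have abK : [set a; b] \in complex_edges K by apply/complex_edgesP; exists a, b, s.
  have := h0 _ abK; rewrite big_setU1 ?inE //= big_set1 => /eqP.
  by rewrite -[X in _ + X]oppF2 subr_eq0 => /eqP.
have /forall_inP/(_ v vt')/eqP-> // : [forall w in t', h w == h u].
apply: (@surface_chain (fun t => [forall w in t, h w == h u]) _ t t') => //.
  move=> t1 t2 w t1K t2K w1 w2 /forall_inP h1; apply/forall_inP => z zt.
  by rewrite (hE t2 z w) // h1.
by apply/forall_inP => w wt; rewrite (hE t w u).
Qed.

Lemma surface_strongly (x : {set 'I_n} -> 'F_2) :
  (forall s, s \in complex_edges K -> \sum_(t in K | s \subset t) x t = 0) ->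
  {in K &, forall t t', x t = x t'}.
Proof.
move=> x0 t t' tK t'K; have [K3 K2 Klink] := K_surface.
apply/esym/eqP; apply: (@surface_chain (fun s => x s == x t) _ t t') => //.
move=> t1 t2 v t1K t2K v1 v2 /eqP <-; apply/eqP/esym.
(* Around a common vertex the link condition leads from one triangle to the other across shared
   edges, and a zero boundary at an edge forces equal values. *)
have /connectP[p pp ->] := Klink v t1 t2 t1K t2K v1 v2.
elim: p t1 {t1K v1} pp => [//|s2 p IHp] s1 /= /andP[/and5P[s1K s2K vs1 vs2 cs] pp].
rewrite -IHp //.
have eK : s1 :&: s2 \in complex_edges K.
  by rewrite inE cs; apply/existsP; exists s1; rewrite s1K finset.subsetIl.
have s12 : s1 != s2.
  by apply: contraTneq cs => ->; rewrite finset.setIid K3.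
have := x0 _ eK.
have EK : [set t in K | s1 :&: s2 \subset t] = [set s1; s2].
  apply/esym/eqP; rewrite eqEcard cards2 s12 K2 // andbT.
  by rewrite finset.subUset !finset.sub1set !inE s1K s2K finset.subsetIl finset.subsetIr.
rewrite (eq_bigl (mem [set s1; s2])) => [|s]; last by rewrite -EK !inE.
rewrite big_setU1 ?inE //= big_set1 => /eqP.
by rewrite -[X in _ + X]oppF2 subr_eq0 => /eqP.
Qed.

Lemma surface_H1 : H1_le K g.
Proof.
have [K3 K2 _] := K_surface.
apply: euler_H1 surface_closed surface_skeleton surface_strongly _.
have f0 : #|faces K 0| = #|complex_vertices K|.
  rewrite -(card_imset _ (@finset.set1_inj 'I_n)); apply: eq_card => s.
  rewrite inE; apply/andP/imsetP => [[/cards1P[v ->] /existsP[t /andP[tK]]]|].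
    rewrite finset.sub1set => vt; exists v => //.
    by rewrite inE; apply/existsP; exists t; rewrite tK.
  move=> [v]; rewrite inE => /existsP[t /andP[tK vt]] ->; rewrite cards1.
  by split=> //; apply/existsP; exists t; rewrite tK finset.sub1set.
have f2 : #|faces K 2| = #|K|.
  apply: eq_card => s; rewrite inE; apply/andP/idP => [[/eqP s3 /existsP[t /andP[tK st]]]|sK].
    suff -> : s = t by [].
    by apply/eqP; rewrite eqEcard st s3 K3.
  by rewrite K3 //; split=> //; apply/existsP; exists s; rewrite sK /=.
have f1 : #|faces K 1| = #|complex_edges K| by [].
move: K_euler; rewrite /euler_characteristic f0 f1 f2; lia.
Qed.

Lemma surface_geometric : geometric_complex (@realization R n K) g 1 K (@vertex_pos R n).
Proof.
split.
- exact: surface_closed.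
- exact: surface_H1.
- exact: realization_cover.
- exact: vertex_pos_inj.
move=> t tK u v ut vt i; rewrite !mxE eqxx /=.
by case: (i == u); case: (i == v); rewrite ?subrr ?subr0 ?sub0r ?normrN ?normr1 ?normr0.
Qed.

End SurfaceComplex.

(** * From arcs to minors *)

Definition far (R : realType) n (A B : set 'rV[R]_n) (d : R) :=
  forall a b, A a -> B b -> ~ (forall i, `|a ord0 i - b ord0 i| <= d).

(** Each point of [A] has a ball that misses [B], and compactness of [A] makes one bound serve all
    points. Stated for all small [d], it can be combined over finitely many pairs of sets. *)
Lemma compact_far (R : realType) n (A B : set 'rV[R]_n) :
  compact A -> compact B -> (forall x, A x -> ~ B x) ->
  (\forall d \near 0^'+, far A B d)%classic.
Proof.
move=> cA cB AB.
have clB : closed B := compact_closed (@norm_hausdorff _ _) cB.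
pose P (d : R) (a : 'rV[R]_n) := forall b, B b -> ~ (forall i, `|a ord0 i - b ord0 i| <= d).
have near_P : forall x, A x -> (\forall x' \near x & e \near 0^'+, P e x')%classic.
  move=> a Aa; have : nbhs a (~` B)%classic.
    by apply: open_nbhs_nbhs; split; [exact: closed_openC|exact: AB].
  move=> /nbhs_ballP[e /= e0 ae].
  exists (ball a (e / 2), [set d | 0 < d < e / 2])%classic => /=.
    split; first by apply: nbhsx_ballx; lra.
    near=> d; apply/andP; split=> //.
    by near: d; apply: nbhs_right_lt; lra.
  move=> [a' d] /= [[_ aa'] /andP[d0 de]] b Bb ab; apply: (ae b) Bb.
  split=> // i j; rewrite ord1; have := aa' ord0 j; rewrite /ball /=.
  have := ab j; have := ler_distD (a' ord0 j) (a ord0 j) (b ord0 j); lra.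
have AP : (\forall e \near 0^'+, (A `<=` P e))%classic :=
  (compact_near_coveringP A).1 cA R _ P _ near_P.
near=> e; move=> a b Aa Bb.
have : (A `<=` P e)%classic by near: e; exact: AP.
by move=> /(_ a Aa b Bb).
Unshelve. all: by end_near. Qed.

Section Neighbourhoods.

Variables (R : realType) (n : nat) (X : set 'rV[R]_n) (d : R).
Variables (T : finType) (K : {set {set T}}) (pos : T -> 'rV[R]_n).
Hypothesis pos_cover : forall x, X x -> exists l, weights K l /\ comb pos l = x.
Hypothesis pos_inj : forall l l', weights K l -> weights K l' ->
  comb pos l = comb pos l' -> l =1 l'.
Hypothesis pos_mesh : mesh_le K pos d.

Definition nbhd (A : set 'rV[R]_n) : {set T} :=
  [set v | `[< exists t x, [/\ t \in K, v \in t, A x & hull pos t x] >]].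

Lemma nbhdP A v :
  (v \in nbhd A) <-> (exists t x, [/\ t \in K, v \in t, A x & hull pos t x]).
Proof. by rewrite inE; split=> /asboolP. Qed.

(** [pos v - x] is a convex combination of differences of vertices of one triangle. *)
Lemma nbhd_near A v : v \in nbhd A ->
  exists x, A x /\ forall i, `|pos v ord0 i - x ord0 i| <= d.
Proof.
move=> /nbhdP[t [x [tK vt Ax [l [l0 l1 lt lx]]]]]; exists x; split=> // i; rewrite -{}lx.
have -> : pos v ord0 i - comb pos l ord0 i =
    \sum_u l u * (pos v ord0 i - pos u ord0 i).
  rewrite -[pos v ord0 i in LHS]mul1r -l1 mulr_suml /comb summxE -sumrB.
  by apply: eq_bigr => u _; rewrite mxE mulrBr.
apply: le_trans (ler_norm_sum _ _ _) _.
rewrite -[leRHS]mul1r -l1 mulr_suml; apply: ler_sum => u _.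
rewrite normrM ger0_norm //; have [->|lu] := eqVneq (l u) 0; first by rewrite !mul0r.
by rewrite ler_wpM2l // (pos_mesh tK) // lt.
Qed.

Lemma nbhd_disjoint A B v : far A B (d + d) -> v \in nbhd A -> v \in nbhd B -> False.
Proof.
move=> AB /nbhd_near[a [Aa va]] /nbhd_near[b [Bb vb]]; apply: (AB a b) => // i.
have := va i; have := vb i; rewrite !ler_norml => /andP[? ?] /andP[? ?].
by apply/andP; split; lra.
Qed.

Lemma nbhd_common A B x : X x -> A x -> B x -> exists v, v \in nbhd A /\ v \in nbhd B.
Proof.
move=> /(cover_hull pos_cover)[t tK tx] Ax Bx.
have [v vt] : exists v, v \in t.
  move: tx => [l [_ l1 lt _]]; apply: contrapT => nv.
  have : \sum_v l v = 0.
    by apply: big1 => v _; apply/eqP; apply: contrapT => /negP /lt vt; apply: nv; exists v.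
  by move/eqP; rewrite l1 oner_eq0.
by exists v; split; apply/nbhdP; exists t, x.
Qed.

Definition nbhd_rel A : rel T :=
  fun a b => [&& [set a; b] \in complex_edges K, a \in nbhd A & b \in nbhd A].

(** All vertices of a triangle meeting [A] lie in the neighbourhood and are pairwise adjacent;
    [complex_chain] links these triangles through shared vertices. *)
Lemma nbhd_connected A : connected A -> (A `<=` X)%classic ->
  {in nbhd A &, forall u v, connect (nbhd_rel A) u v}.
Proof.
move=> cA AX u v /nbhdP[t [x [tK ut Ax tx]]] /nbhdP[t' [x' [t'K vt' Ax' t'x']]].
have adj s y a b : s \in K -> A y -> hull pos s y -> a \in s -> b \in s ->
    connect (nbhd_rel A) a b.
  move=> sK Ay sy as_ bs; have [->//|ab] := eqVneq a b.
  apply: connect1; apply/and3P; split.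
  - by apply/complex_edgesP; exists a, b, s.
  - by apply/nbhdP; exists s, y.
  - by apply/nbhdP; exists s, y.
pose P : pred {set T} := fun s => [forall w in s, connect (nbhd_rel A) u w].
suff /forall_inP/(_ v vt') : P t' by [].
have := @complex_chain _ _ _ _ _ _ pos_cover pos_inj A P cA AX _ _ _ _ _
  tK t'K Ax tx Ax' t'x'; apply.
  move=> t1 t2 w y1 y2 t1K t2K w1 w2 Ay1 t1y1 Ay2 t2y2 /forall_inP/(_ w w1) uw.
  by apply/forall_inP => z zt; apply: connect_trans uw (adj t2 y2 w z _ _ _ _ _).
by apply/forall_inP => w wt; exact: (adj t x).
Qed.

End Neighbourhoods.

Lemma connect_exit (T : finType) (r : rel T) (S : pred T) a b :
  connect r a b -> S a -> ~~ S b -> exists x y, [/\ S x, ~~ S y & r x y].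
Proof.
move=> /connectP[p pp ->] {b}; elim: p a pp => [|c p IHp] a /=; first by move=> _ ->.
move=> /andP[ac pp] Sa Sb; have [Sc|Sc] := boolP (S c); first exact: IHp Sb.
by exists a, c.
Qed.

Lemma sub_connect_in (T : finType) (r r' : rel T) (S : pred T) a b :
  (forall x y, S x -> r x y -> S y /\ r' x y) -> S a -> connect r a b -> connect r' a b.
Proof.
move=> rr' Sa /connectP[p pp ->] {b}; elim: p a Sa pp => [//|c p IHp] a Sa /=.
move=> /andP[/(rr' _ _ Sa)[Sc ac] pp].
exact: connect_trans (connect1 ac) (IHp c Sc pp).
Qed.

(** * Branch sets and bridges from stars and bonds *)

Section TopologicalMinor.

Variables (R : realType) (n g : nat) (X : set 'rV[R]_n).
Variables (V I : finType) (pu pv : I -> V).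
Variables (star : V -> set 'rV[R]_n) (bond : I -> set 'rV[R]_n).
Hypothesis V_gt0 : (0 < #|V|)%N.
Hypothesis pu_pv : forall i, pu i != pv i.
Hypothesis ends_inj : injective (fun i => [set pu i; pv i]).
Hypothesis star_compact : forall v, compact (star v).
Hypothesis star_connected : forall v, connected (star v).
Hypothesis star_sub : forall v, (star v `<=` X)%classic.
Hypothesis bond_compact : forall i, compact (bond i).
Hypothesis bond_connected : forall i, connected (bond i).
Hypothesis bond_sub : forall i, (bond i `<=` X)%classic.
Hypothesis star_star : forall u v x, u != v -> star u x -> ~ star v x.
Hypothesis bond_bond : forall i j x, i != j -> bond i x -> ~ bond j x.
Hypothesis star_bond : forall u i x, u != pu i -> u != pv i -> star u x -> ~ bond i x.
Hypothesis star_pu : forall i, exists x, star (pu i) x /\ bond i x.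
Hypothesis star_pv : forall i, exists x, star (pv i) x /\ bond i x.
Hypothesis X_fine : forall eps : R, 0 < eps ->
  exists (T : finType) (K : {set {set T}}) (pos : T -> 'rV[R]_n),
    geometric_complex X g eps K pos.

Lemma all_far : exists2 d : R, 0 < d & [/\ forall u v, u != v -> far (star u) (star v) (d + d),
  forall i j, i != j -> far (bond i) (bond j) (d + d) &
  forall u i, u != pu i -> u != pv i -> far (star u) (bond i) (d + d)].
Proof.
have far0 A B : compact A -> compact B -> (forall x, A x -> ~ B x) ->
    (\forall d \near 0^'+, far A B (d : R))%classic := @compact_far R n A B.
have H1 : (\forall d \near 0^'+, forall p : V * V, p.1 != p.2 ->
    far (star p.1) (star p.2) (d : R))%classic.
  apply: filter_forall => -[u v] /=; have [->|uv] := eqVneq u v.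
    by near=> d.
  have := far0 _ _ (@star_compact u) (@star_compact v) (fun x => star_star uv).
  by apply: filterS => d.
have H2 : (\forall d \near 0^'+, forall p : I * I, p.1 != p.2 ->
    far (bond p.1) (bond p.2) (d : R))%classic.
  apply: filter_forall => -[u v] /=; have [->|uv] := eqVneq u v.
    by near=> d.
  have := far0 _ _ (@bond_compact u) (@bond_compact v) (fun x => bond_bond uv).
  by apply: filterS => d.
have H3 : (\forall d \near 0^'+, forall p : V * I, p.1 != pu p.2 -> p.1 != pv p.2 ->
    far (star p.1) (bond p.2) (d : R))%classic.
  apply: filter_forall => -[u i] /=.
  have [->|u1] := eqVneq u (pu i); first by near=> d.
  have [->|u2] := eqVneq u (pv i); first by near=> d.
  have := far0 _ _ (@star_compact u) (@bond_compact i) (fun x => star_bond u1 u2).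
  by apply: filterS => d.
have [d [d0 [F1 [F2 F3]]]] : exists d : R, 0 < d /\
   ((forall p : V * V, p.1 != p.2 -> far (star p.1) (star p.2) d) /\
   ((forall p : I * I, p.1 != p.2 -> far (bond p.1) (bond p.2) d) /\
   (forall p : V * I, p.1 != pu p.2 -> p.1 != pv p.2 -> far (star p.1) (bond p.2) d))).
  apply: (@filter_ex _ (0^'+)%classic).
  near=> d; split=> //; split; first by near: d; exact: H1.
  by split; near: d; [exact: H2|exact: H3].
(* Two neighbourhoods can each reach one mesh width towards the other, so the sets must be more than
   two mesh widths apart. *)
exists (d / 2); first by lra.
have -> : d / 2 + d / 2 = d by lra.
split=> [u v|i j|u i]; [exact: (F1 (u, v))|exact: (F2 (i, j))|exact: (F3 (u, i))].
Unshelve. all: by end_near. Qed.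

Theorem topological_minor_bound :
  (#|I| < #|V| + g)%N \/ (#|I| + 6 <= 3 * (#|V| + g))%N.
Proof.
have [d d0 [far_star far_bond far_star_bond]] := all_far.
have [T [K [pos [Kclosed KH1 cov inj mesh]]]] := X_fine d0.
pose N := nbhd K pos.
pose D v := N (star v); pose M i := N (bond i).
have DD u v a : a \in D u -> a \in D v -> u = v.
  move=> au av; apply: contrapT => /eqP uv.
  exact: (nbhd_disjoint mesh (far_star _ _ uv) au av).
have MM i j a : a \in M i -> a \in M j -> i = j.
  move=> ai aj; apply: contrapT => /eqP ij.
  exact: (nbhd_disjoint mesh (far_bond _ _ ij) ai aj).
have DM u i a : a \in D u -> a \in M i -> u = pu i \/ u = pv i.
  move=> au ai; apply: contrapT => /not_orP[/eqP u1 /eqP u2].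
  exact: (nbhd_disjoint mesh (far_star_bond _ _ u1 u2) au ai).
pose r i : rel T := fun a b => [&& [set a; b] \in complex_edges K, a \in M i & b \in M i]
  && ((a \notin D (pv i)) && (b \notin D (pv i))).
(* The part of [M i] that can be reached from [D (pu i)] without entering [D (pv i)]; it is added to
   the branch set of [pu i]. *)
pose C i : {set T} := [set b in M i | (b \notin D (pv i)) &&
  [exists a in D (pu i) :&: M i, connect (r i) a b]].
have CP i b : b \in C i -> exists a, [/\ a \in D (pu i), a \in C i & connect (r i) a b].
  rewrite inE => /and3P[bM bD /exists_inP[a]]; rewrite inE => /andP[aD aM] ab.
  exists a; split=> //; rewrite inE aM.
  have -> : a \notin D (pv i).
    by apply/negP => /(DD _ _ _ aD)/eqP; rewrite (negPf (pu_pv i)).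
  by apply/exists_inP; exists a; rewrite // inE aD.
have C_step i a b : a \in C i -> r i a b -> b \in C i.
  move=> /CP[a0 [a0D a0C a0a]] ab; have /andP[/and3P[_ _ bM] /andP[_ bD]] := ab.
  rewrite inE bM bD /=; apply/exists_inP; exists a0.
    by rewrite inE a0D; move: a0C; rewrite inE => /andP[].
  exact: connect_trans a0a (connect1 ab).
pose Dplus v a := (a \in D v) || [exists i, (pu i == v) && (a \in C i)].
have CM i a : a \in C i -> a \in M i /\ a \notin D (pv i).
  by rewrite inE => /and3P[].
(* Distinct [D] are disjoint, and so are distinct [M]. [M i] meets [D w] only if [w] is an end of
   [i], and [C i] avoids [D (pv i)]. *)
have Dplus_inj u v a : Dplus u a -> Dplus v a -> u = v.
  have DC w i : a \in D w -> a \in C i -> w = pu i.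
    move=> aw /CM[aM aN]; have [//|wE] := DM _ _ _ aw aM.
    by rewrite -wE aw in aN.
  move=> /orP[au|/existsP[i /andP[/eqP <- ai]]] /orP[av|/existsP[j /andP[/eqP <- aj]]].
  - exact: DD au av.
  - exact: DC au aj.
  - by rewrite (DC _ _ av ai).
  - by rewrite (MM i j a (CM _ _ ai).1 (CM _ _ aj).1).
pose lab a := [pick v | Dplus v a].
have labP a v : (lab a == Some v) = Dplus v a.
  rewrite /lab; case: pickP => [w aw|/(_ v) ->//].
  apply/eqP/idP => [[<-]//|av]; congr Some; exact: Dplus_inj aw av.
pose rl v : rel T := fun x y => [&& [set x; y] \in complex_edges K, lab x == Some v &
    lab y == Some v].
have rl_sym v : connect_sym (rl v).
  apply: sym_connect_sym => x y; rewrite /rl finset.setUC; congr (_ && _).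
  by rewrite andbC.
have to_D v a : Dplus v a -> exists2 b, b \in D v & connect (rl v) b a.
  case/orP => [aD|/existsP[i /andP[/eqP iv aC]]]; first by exists a.
  have [b [bD bC ba]] := CP _ _ aC; exists b; first by rewrite -iv.
  have Ci x : x \in C i -> Dplus v x.
    by move=> xC; apply/orP; right; apply/existsP; exists i; rewrite iv eqxx.
  apply: (sub_connect_in (S := mem (C i))) bC ba => x y xC xy.
  have yC := C_step _ _ _ xC xy; split=> //.
  by rewrite /rl !labP !Ci //; have /andP[/and3P[-> _ _] _] := xy.
have lab_conn v a b : lab a = Some v -> lab b = Some v -> connect (rl v) a b.
  move=> /eqP; rewrite labP => /to_D[a' a'D a'a] /eqP; rewrite labP => /to_D[b' b'D b'b].
  apply: connect_trans (_ : connect _ a b') b'b.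
  rewrite rl_sym in a'a; apply: connect_trans a'a _.
  have := nbhd_connected cov inj (@star_connected v) (@star_sub v) a'D b'D.
  apply: (sub_connect_in (S := mem (D v))) a'D => x y xD /and3P[xy _ yD].
  by split=> //; rewrite /rl xy !labP /Dplus (xD : x \in D v) (yD : y \in D v).
have bridge_ex i : exists s : {set T}, s \in complex_edges K /\
    lab @: s = Some @: [set pu i; pv i].
  have [x [xu xi]] := star_pu i; have [y [yv yi]] := star_pv i.
  have [a [aD aM]] := nbhd_common cov (star_sub xu) xu xi.
  have [b [bD bM]] := nbhd_common cov (star_sub yv) yv yi.
  have ab := nbhd_connected cov inj (@bond_connected i) (@bond_sub i) aM bM.
  have aC : a \in C i.
    rewrite inE aM; have -> : a \notin D (pv i).
      by apply/negP => /(DD _ _ _ aD)/eqP; rewrite (negPf (pu_pv i)).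
    by apply/exists_inP; exists a; rewrite // inE aD.
  have bC : b \notin C i by apply/negP => /CM[_]; rewrite bD.
  (* A path in [M i] between the two ends must leave [C i]; the vertex it then enters is in
     [D (pv i)], or it would be reachable too. The edge crossed is the bridge. *)
  have [z [w [zC wC /and3P[zw zM wM]]]] := connect_exit (S := mem (C i)) ab aC bC.
  have wD : w \in D (pv i).
    apply: contraT => wN; case/negP: wC; apply: (C_step i z) => //.
    by rewrite /r zw zM wM wN (CM _ _ zC).2.
  exists [set z; w]; split=> //; rewrite !imsetU1 !imset_set1.
  have /eqP -> : lab z == Some (pu i).
    by rewrite labP /Dplus; apply/orP; right; apply/existsP; exists i; rewrite eqxx.
  by have /eqP -> : lab w == Some (pv i) by rewrite labP /Dplus wD.
have /choice[bridge bridgeP] := bridge_ex.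
apply: (@minor_edge_bound T V I K g lab (fun i => [set pu i; pv i]) bridge) => //.
- by move=> i; rewrite cards2 pu_pv.
- by move=> i; have [] := bridgeP i.
- by move=> i; have [] := bridgeP i.
Qed.

End TopologicalMinor.

(** * Stars and bonds of an embedded graph *)

Section Embedding.

Variables (R : realType) (V : finType) (e : rel V) (S : topologicalType) (g : nat).
Hypothesis e_simple : simple_graph e.
Hypothesis S_surface : closed_surface R S.
Hypothesis S_genus : has_euler_genus R S g.
Hypothesis e_embeds : embeds_in R e S.

Theorem embedding_edge_bound :
  (#|edge_set e| < #|V| + g)%N \/ (#|edge_set e| + 6 <= 3 * (#|V| + g))%N.
Proof.
have [e_sym e_irr V_gt0] := e_simple.
have [[x0 _] _ _ S_conn _] := S_surface.
have [n [K [Ksurf [f [h [fh hf cf _]]] Kg]]] := S_genus.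
have [p [gamma [p_inj arcs arc_vertex arc_arc]]] := e_embeds.
pose X := @realization R n K.
have fX x : X (f x) by have [] := fh x I.
have f_inj : injective f by move=> x y fxy; rewrite -(fh x I).2 fxy (fh y I).2.
have f_cont : continuous f.
  by move=> x; have := cf; rewrite (continuous_open_subspace _ openT); apply; rewrite inE.
have X_geo : geometric_complex X g 1 K (@vertex_pos R n).
  apply: surface_geometric Ksurf _ Kg.
  rewrite (_ : @realization R n K = f @` [set: S])%classic.
    exact: connected_continuous_connected.
  apply/seteqP; split=> [y Xy|_ [x _ <-]]; last exact: fX.
  by exists (h y) => //; exact: (hf y Xy).2.
pose G u v t := f (gamma u v t).
have G_cont u v (a b : R) : e u v -> 0 <= a -> b <= 1 ->
    {within `[a, b], continuous (G u v)}%classic.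
  move=> uv a0 b1.
  have c01 : {within `[0, 1], continuous (G u v)}%classic.
    apply: within_continuous_comp; first by move=> x _; exact: f_cont.
    by have [] := arcs u v uv.
  apply: continuous_subspaceW c01 => t /=.
  by rewrite !in_itv /= => /andP[? ?]; apply/andP; split; lra.
have G_inj u v s t : e u v -> 0 <= s <= 1 -> 0 <= t <= 1 -> G u v s = G u v t -> s = t.
  move=> uv s01 t01 /f_inj E; have [_ inj _ _ _] := arcs u v uv.
  by apply: inj E; rewrite in_itv.
have G0 u v : e u v -> G u v 0 = f (p u).
  by move=> uv; rewrite /G; have [_ _ -> _ _] := arcs u v uv.
have Grev u v t : e u v -> 0 <= t <= 1 -> G v u t = G u v (1 - t).
  by move=> uv t01; rewrite /G; have [_ _ _ _ ->] := arcs u v uv; rewrite ?in_itv.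
have G_vertex u v w t : e u v -> 0 < t < 1 -> G u v t <> f (p w).
  by move=> uv t01 /f_inj; apply: arc_vertex; rewrite ?in_itv.
have G_arc u v u' v' t t' : e u v -> e u' v' -> [set u; v] != [set u'; v'] ->
    0 < t < 1 -> 0 < t' < 1 -> G u v t <> G u' v' t'.
  by move=> uv uv' ne t01 t'01 /f_inj; apply: arc_arc; rewrite ?in_itv.
(* For a non-neighbour [w] the branch is just the base point, so that the star of an isolated vertex
   is nonempty. *)
pose branch v w := (if e v w then G v w @` `[0, 3^-1] else [set f (p v)])%classic.
pose star v := (\bigcup_w branch v w)%classic.
have branch_base v w : branch v w (f (p v)).
  rewrite /branch; case: ifP => // vw; exists 0; last exact: G0.
  by rewrite /= in_itv /= lexx /=; lra.
have starP v x : star v x -> x = f (p v) \/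
    exists w t, [/\ e v w, 0 < t <= 3^-1 & x = G v w t].
  move=> [w _]; rewrite /branch; case: ifP => [vw|_ ->]; last by left.
  move=> [t]; rewrite /= in_itv /= => /andP[t0 t3] <-.
  have [->|tn0] := eqVneq t 0; first by left; exact: G0.
  by right; exists w, t; rewrite lt_def tn0 t0.
have /choice[pr prP] : forall s : {s : {set V} | s \in edge_set e},
    exists uv : V * V, e uv.1 uv.2 /\ val s = [set uv.1; uv.2].
  by move=> [s sE]; have /edge_setP[u [v uv]] := sE; exists (u, v).
pose pu i := (pr i).1; pose pv i := (pr i).2.
have e_uv i : e (pu i) (pv i) by exact: (prP i).1.
pose bond i := (G (pu i) (pv i) @` `[3^-1, 2 / 3])%classic.
have -> : #|edge_set e| = #|{: {s : {set V} | s \in edge_set e}}|.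
  by rewrite card_sig; apply: eq_card => s; rewrite inE.
have branch_comp v w : compact (branch v w).
  rewrite /branch; case: ifP => vw; last exact: compact_set1.
  apply: continuous_compact; last exact: segment_compact.
  by apply: G_cont => //; lra.
have branch_conn v w : connected (branch v w).
  rewrite /branch; case: ifP => vw; last exact: connected1.
  apply: connected_continuous_connected; first exact: segment_connected.
  by apply: G_cont => //; lra.
apply: (@topological_minor_bound R n g X V _ pu pv star bond) => //.
- by move=> i; apply: contraTneq (e_uv i) => ->; rewrite e_irr.
- by move=> i j ij; apply: val_inj; rewrite (prP i).2 (prP j).2.
- move=> v; rewrite (_ : star v = \big[setU/set0]_(w <- enum V) branch v w)%classic.
    by apply: bigsetU_compact => w _; exact: branch_comp.
  rewrite -bigcup_seq; apply/seteqP; split=> x [w _ xw]; exists w => //.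
  by rewrite /= mem_enum.
- move=> v; apply: bigcup_connected => //; exists (f (p v)) => w _.
  exact: branch_base.
- move=> v x [w _]; rewrite /branch; case: ifP => [_ [t _ <-]|_ ->]; exact: fX.
- move=> i; apply: continuous_compact; last exact: segment_compact.
  by apply: G_cont => //; lra.
- move=> i; apply: connected_continuous_connected; first exact: segment_connected.
  by apply: G_cont => //; lra.
- by move=> i x [t _ <-]; exact: fX.
- move=> u v x uv /starP[->|[w [t [uw /andP[t0 t3] ->]]]] /starP.
    move=> [/f_inj/p_inj/eqP|[w [t [vw /andP[t0 t3] E]]]]; first by rewrite (negPf uv).
    by apply: (@G_vertex v w u t) => //; apply/andP; split; lra.
  move=> [E|[w' [t' [vw' /andP[t'0 t'3] E]]]].
    by apply: (@G_vertex u w v t) => //; apply/andP; split; lra.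
  have [Ee|ne] := eqVneq [set u; w] [set v; w']; last first.
    by apply: (G_arc _ _ _ _ _ _ uw vw' ne _ _ E); apply/andP; split; lra.
  have uw' : u = w'.
    have : u \in [set v; w'] by rewrite -Ee !inE eqxx.
    by rewrite !inE (negPf uv) => /eqP.
  have vw : v = w.
    have : v \in [set u; w] by rewrite Ee !inE eqxx.
    by rewrite !inE eq_sym (negPf uv) => /eqP.
  (* Both points lie on the arc of [u v], in opposite outer thirds: [t <= 1/3] while
     [1 - t' >= 2/3]. *)
  move: E; rewrite -vw -uw' in uw vw' *; rewrite (Grev u v) //; last by apply/andP; split; lra.
  by move/G_inj => E; have := E uw; rewrite (_ : (0 <= t <= 1) = true); lra.
- move=> i j x ij [t] /=; rewrite in_itv /= => /andP[t1 t2] <- [t'] /=.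
  rewrite in_itv /= => /andP[t'1 t'2]; apply: G_arc => //.
  + by rewrite -(prP i).2 -(prP j).2 eq_sym val_eqE.
  + by apply/andP; split; lra.
  + by apply/andP; split; lra.
- move=> u i x u1 u2 /starP ux [t] /=; rewrite in_itv /= => /andP[t1 t2] E.
  have t01 : 0 < t < 1 by apply/andP; split; lra.
  case: ux => [xE|[w [t' [uw /andP[t'0 t'3] xE]]]].
    by apply: (G_vertex _ _ u _ (e_uv i) t01); rewrite E.
  apply: (G_arc _ _ _ _ _ _ (e_uv i) uw _ t01 _); last by rewrite E; exact: xE.
    apply/eqP => Ee; have : u \in [set pu i; pv i] by rewrite Ee !inE eqxx.
    by rewrite !inE (negPf u1) (negPf u2).
  by apply/andP; split; lra.
- move=> i; exists (G (pu i) (pv i) 3^-1); split.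
    exists (pv i) => //; rewrite /branch e_uv; exists 3^-1 => //.
    by rewrite /= in_itv /=; apply/andP; split; lra.
  by exists 3^-1 => //; rewrite /= in_itv /=; apply/andP; split; lra.
(* The parameter 2/3 becomes 1/3 on the reversed arc, where the star of [pv i] ends. *)
- move=> i; exists (G (pu i) (pv i) (2 / 3)); split.
    exists (pu i) => //; rewrite /branch e_sym e_uv; exists 3^-1.
      by rewrite /= in_itv /=; apply/andP; split; lra.
    by rewrite (Grev (pu i)) //; [congr G; lra|apply/andP; split; lra].
  by exists (2 / 3) => //; rewrite /= in_itv /=; apply/andP; split; lra.
- move=> eps; exact: geometric_fine X_geo.
Qed.

End Embedding.

(** * Arithmetic *)

(** With s the square root, the hypothesis reads s >= 4 i - 3, so (7 + s) / 2 >= 2 i + 2 and the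
    floor H is at least 2 i + 2. From H + 1 > (7 + s) / 2 follows s < 2 H - 5, which is 4 i + 2 j -
    1. *)
Lemma heawood_bounds (R : realType) (i g : nat) : (2 <= i)%N ->
  i%:R <= (3 + Num.sqrt (24 * g%:R + 1)) / 4 :> R ->
  exists j : nat, heawood R g = (2 * i + 2 + j)%N /\
    (24 * g + 1 < (4 * i + 2 * j - 1) ^ 2)%N.
Proof.
move=> i2 hi; set s := Num.sqrt _ in hi.
have s2 : s ^+ 2 = 24 * g%:R + 1 by rewrite sqr_sqrtr // addr_ge0 // mulr_ge0.
have s0 : 0 <= s by exact: sqrtr_ge0.
have := truncnS_gt ((7 + s) / 2 : R); rewrite -/(heawood R g).
rewrite -[(heawood R g).+1%:R]natr1 => hs.
have : (2 * i + 1 < heawood R g)%N.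
  by rewrite -(ltr_nat R) natrD natrM; lra.
move=> /subnKC hE; exists (heawood R g - (2 * i + 1).+1)%N.
have {}hE : heawood R g = (2 * i + 2 + (heawood R g - (2 * i + 1).+1))%N by lia.
split=> //; move: hE hs; move: (heawood R g - _)%N => j -> hs.
rewrite -(ltr_nat R) natrX natrB; last by lia.
have -> : (24 * g + 1)%:R = 24 * g%:R + 1 :> R by rewrite natrD natrM.
have -> : (4 * i + 2 * j)%:R = 4 * i%:R + 2 * j%:R :> R by rewrite natrD !natrM.
have hE : (2 * i + 2 + j)%:R = 2 * i%:R + 2 + j%:R :> R.
  by rewrite natrD natrD natrM.
rewrite {}hE in hs; rewrite -s2.
have i2' : 2 <= i%:R :> R by rewrite (ler_nat R 2).
have j0 : 0 <= j%:R :> R by [].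
by rewrite ltr_pXn2r ?nnegrE //; lra.
Qed.

Theorem theorem2 (R : realType) (i g : nat) (hi : (2 <= i)%N) (hg : (1 <= g)%N) :
  ((2 * i%:R ^+ 2 - 3 * i%:R + 1) / 3 <= g%:R :> R <->
   i%:R <= (3 + Num.sqrt (24 * g%:R + 1)) / 4 :> R) /\
  ((2 * i%:R ^+ 2 - 3 * i%:R + 1) / 3 <= g%:R :> R ->
   forall (V : finType) (e : rel V) (S : topologicalType),
     simple_graph e -> closed_surface R S -> has_euler_genus R S g ->
     embeds_in R e S -> property_M e (heawood R g - i)%N).
Proof.
(* As 4 i - 3 > 0, both sides say that (4 i - 3)^2 <= 24 g + 1. *)
have iff : (2 * i%:R ^+ 2 - 3 * i%:R + 1) / 3 <= g%:R :> R <->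
   i%:R <= (3 + Num.sqrt (24 * g%:R + 1)) / 4 :> R.
  have i2 : 2 <= i%:R :> R by rewrite (ler_nat R 2).
  have g0 : 0 <= g%:R :> R by [].
  have s2 : Num.sqrt (24 * g%:R + 1 : R) ^+ 2 = 24 * g%:R + 1 by rewrite sqr_sqrtr //; lra.
  have s0 := sqrtr_ge0 (24 * g%:R + 1 : R).
  move: (Num.sqrt _) s2 s0 => s; move: (i%:R) (g%:R) i2 g0 => {hi hg}i' g' i2 g0 s2 s0.
  split=> h; last by nra.
  by rewrite leNgt; apply/negP => h'; nra.
split=> // /iff hi4 V e S e_simple S_surf S_genus e_emb [C [L [Lk uniq]]].
have [e_sym e_irr V_gt0] := e_simple.
have [j [hE gj]] := heawood_bounds hi hi4.
have kE : (heawood R g - i = (i + 1 + j).+1)%N by rewrite hE; lia.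
rewrite kE in Lk.
have lower := unique_coloring_edges Lk uniq.
have upper := card_edge_set_le e_irr; rewrite bin2 in upper.
have euler := embedding_edge_bound e_simple S_surf S_genus e_emb.
move: lower upper euler V_gt0; move: #|edge_set e| #|V| => m n lower upper euler n0.
set k := (i + 1 + j)%N in lower.
(* Lists have [k + 1] colors, so [k * n <= m <= n * (n - 1) / 2]. *)
have nk : (2 * k + 1 <= n)%N.
  have : (m.*2 <= n * n.-1)%N by rewrite -geq_half_double.
  rewrite -mul2n => /(leq_trans (leq_mul (leqnn 2) lower)).
  rewrite mulnA mulnC leq_pmul2l //; lia.
have k3 : (3 <= k)%N by rewrite /k; lia.
have gk : (24 * g + 1 < (4 * k - 5) ^ 2)%N.
  by apply: leq_trans gj _; rewrite leq_exp2r // /k; lia.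
(* The bound [gk] with its square expanded, divided by 8. *)
have gk' : (3 * g + 5 * k < 2 * k * k + 3)%N.
  move: k3 gk; clear; move=> /subnKC <-; move: (k - 3)%N => q.
  have -> : (4 * (3 + q) - 5 = 4 * q + 7)%N by lia.
  by rewrite expnS expn1; nia.
(* Both alternatives fail for n >= 2 k + 1 and k >= 3. The first needs (k - 1) n < g. The second
   needs (k - 3) n + 6 <= 3 g, but at n = 2 k + 1 its left side is already 2 k^2 - 5 k + 3, which
   exceeds 3 g by [gk']. *)
have [a nE] : exists a, n = (2 * k + 1 + a)%N by exists (n - (2 * k + 1))%N; lia.
move: k3 gk' lower euler; rewrite nE; move: (k) => q; clear.
move=> /subnKC <-; move: (q - 3)%N => {}q; case; nia.
Qed.
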